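(* Let $G=(V,E)$ be a connected rooted graph of bounded degree, let $a>0$, and consider the once-reinforced random walk ORRW($a$) on $G$ started at the root $0$. Fix $n\in\mathbb N=\{0,1,2,\dots\}$. For any event $A\in\mathcal F_{\tau_n}$, $$\mathbb P^{(a)}(A)=\mathbb E\left[\exp\left\{(1-a)\sum_{e\in E}T_e(\tau_n)+(\log a)\,|\mathfrak C_{\tau_n}|\right\}\mathbf 1_A\right].$$
   Context: ORRW($a$), with law $\mathbb P^{(a)}$: the right-continuous nearest-neighbour continuous-time process $\mathbf X=(X_t)_{t\ge0}$ on $V$ with $X_0=0$ such that, with $\mathfrak C_t$ the set of (unoriented) edges traversed by time $t$ and $\mathcal F_t=\sigma(X_s:s\le t)$, on $\{X_t=i\}$ and for every neighbour $j$ of $i$, $\mathbb P(X_{t+h}=j\mid\mathcal F_t)=h\mathbf 1_{\{\{i,j\}\in\mathfrak C_t\}}+a h\mathbf 1_{\{\{i,j\}\notin\mathfrak C_t\}}+o(h)$, and the probability of more than one jump in $(t,t+h)$ is $o(h)$. $\mathbb P,\mathbb E$ (no superscript) refer to the case $a=1$, i.e. continuous-time simple random walk jumping across each incident edge at rate one. $\tau_0=0$ and $\tau_n=\inf\{t>\tau_{n-1}:X_t\ne X_{\tau_{n-1}}\}$ are the jump times; $|\cdot|$ is cardinality. For $e\in E$, $\mathbb L_e$ is the first time edge $e$ is traversed (in either direction), and $$T_e(\tau_n):=\int_0^{\mathbb L_e\wedge\tau_n}\mathbf 1_{\{X_u\sim e\}}\,du,$$ where $x\sim e$ means that the edge $e$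 is incident to the vertex $x$. *)

(* Defs.v *)
From HB Require Import structures.
From mathcomp Require Export all_boot all_order all_algebra.
From mathcomp Require Export finmap.
From mathcomp Require Export all_classical all_reals all_analysis.
Export numFieldNormedType.Exports.

Set Implicit Arguments.
Unset Strict Implicit.
Unset Printing Implicit Defensive.

Import Order.TTheory GRing.Theory Num.Theory.
Local Open Scope classical_set_scope.
Local Open Scope ring_scope.

Section Graph.
Context {V : Type} (adj : rel V).

Definition simple_graph : Prop := symmetric adj /\ irreflexive adj.

Definition connected_graph : Prop :=
  forall x y : V, exists2 p : seq V, path adj x p & last x p = y.

Definition bounded_degree : Prop :=
  exists D : nat, forall x : V, ([set y | adj x y] #<= `I_D)%card.

(* An unoriented edge is the two-point set of its endpoints, so that a vertex
   [x] is incident to [e] exactly when [e x]. *)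
Definition edges : set (set V) :=
  [set e | exists x y : V, adj x y /\ e = [set x; y]].

End Graph.

(* Functionals of a path [p : R -> V]; only the times [t >= 0] matter. *)
Section Paths.
Context {R : realType} {V : Type}.
Implicit Types (p : R -> V) (e : set V) (s t : R).

Definition left_value p s (x : V) : Prop := \forall u \near s^'-, p u = x.

Definition jump_time p s : Prop :=
  0 < s /\ exists2 x : V, left_value p s x & x <> p s.

Definition traverses p e s : Prop :=
  0 < s /\ exists x : V, [/\ left_value p s x, x <> p s & e = [set x; p s]].

(* The condition at [s > 0] says that [p] has a left limit in the discrete
   space [V], and that it either does not jump at [s] or jumps along an edge. *)
Definition nearest_neighbour_path (adj : rel V) (o : V) p : Prop :=
  [/\ p 0 = o,
      forall t, 0 <= t -> \forall u \near t^'+, p u = p t &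
      forall s, 0 < s ->
        exists2 x : V, left_value p s x & x = p s \/ adj x (p s)].

Local Open Scope ereal_scope.

(* [tau p n.+1 = +oo] when there is no jump after [tau p n]; if
   [tau p n = +oo] the set is empty and [fine] plays no role. *)
Fixpoint tau p (n : nat) : \bar R :=
  if n is m.+1 then
    ereal_inf [set t%:E | t in
      [set t : R | tau p m < t%:E /\ p t <> p (fine (tau p m))]]
  else 0.

Definition traversed_edges p (T : \bar R) : set (set V) :=
  [set e | exists s, s%:E <= T /\ traverses p e s].

Definition first_traversal p e : \bar R :=
  ereal_inf [set s%:E | s in traverses p e].

Definition unreinforced_time p e (T : \bar R) : \bar R :=
  \int[@lebesgue_measure R]_(u in
      [set u : R | 0 <= u%:E <= Order.min (first_traversal p e) T])
    (\1_[set u : R | e (p u)] u)%:E.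

End Paths.

Section Process.
Context {R : realType} {V : Type} {d : measure_display} {Omega : measurableType d}.
Variable X : Omega -> R -> V.

Definition nearest_neighbour_process (adj : rel V) (o : V) : Prop :=
  (forall (t : R) (B : set V), 0 <= t ->
     measurable [set w | B (X w t)]) /\
  (forall w : Omega, nearest_neighbour_path adj o (X w)).

Definition sigma_upto (T : \bar R) : set (set Omega) :=
  <<s [set A | exists (s : R) (B : set V),
         [/\ 0 <= s, (s%:E <= T)%E & A = [set w | B (X w s)]] ] >>.

Definition stopped_sigma (S : Omega -> \bar R) : set (set Omega) :=
  [set A | sigma_upto +oo A /\
     forall t : R, 0 <= t ->
       sigma_upto t%:E (A `&` [set w | (S w <= t%:E)%E])].

(* [f] is a version of [P(A | G)]. *)
Definition is_cond_prob (P : probability Omega R) (G : set (set Omega))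
    (A : set Omega) (f : Omega -> R) : Prop :=
  [/\ forall B : set R, measurable B -> G (f @^-1` B),
      P.-integrable setT (EFin \o f) &
      forall B : set Omega, G B -> (\int[P]_(w in B) (f w)%:E = P (A `&` B))%E].

Definition little_o_at0 (eps : R -> R) : Prop :=
  eps h / h @[h --> 0^'+] --> (0 : R).

(* The [o(h)] terms are uniform in the time [t] and in the conditioning:
   with [t]-dependent error terms, a process making an additional jump at a
   fixed deterministic time would also satisfy these conditions.  On a graph of
   bounded degree the jump rates are bounded, so this uniformity is automatic
   for the walk with the prescribed rates. *)
Definition orrw (adj : rel V) (a : R) (P : probability Omega R) : Prop :=
  (forall i j : V, adj i j ->
     exists2 eps : R -> R, little_o_at0 eps &
       forall t h : R, 0 <= t -> 0 < h ->
         exists2 f : Omega -> R,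
           is_cond_prob P (sigma_upto t%:E) [set w | X w (t + h) = j] f &
           {ae P, forall w, X w t = i ->
              `| f w - (if `[< traversed_edges (X w) t%:E [set i; j] >]
                        then h else a * h) | <= eps h}) /\
  (exists2 eps : R -> R, little_o_at0 eps &
     forall t h : R, 0 <= t -> 0 < h ->
       (P [set w | exists s1 s2 : R,
             [/\ (t < s1)%R, (s1 < s2)%R, (s2 < t + h)%R,
                 jump_time (X w) s1 & jump_time (X w) s2]] <= (eps h)%:E)%E).

End Process.

(* Main.v *)
Require Import Defs.
From mathcomp Require Import measurable_realfun ring lra zify.
(* On a graph of bounded degree the list of visited vertices ("history") is a
   pure jump process: from a history z it jumps to z extended by j at rate 1 or
   a, according to whether the edge to j is already explored.  If Z is the time
   integral of (1 - a) * (number of unexplored edges at the current vertex) and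
   C the number of explored edges, then P^(a)(B, history at t = z) and
   E[exp Z a^C; B, history at t = z], with B in the past of s <= t, satisfy the
   same triangular system of linear equations up to o(h) per step of length h,
   so they agree at t as soon as they agree at s.  Starting from time 0 this
   gives equality on cylinders, hence on F_t.  At a jump time, F_(tau_n) is
   approached from the right along dyadic grids, on the event that no further
   jump occurs before the next grid point. *)
Set Implicit Arguments.
Unset Strict Implicit.
Unset Printing Implicit Defensive.
Import Order.TTheory GRing.Theory Num.Theory.
Local Open Scope classical_set_scope.
Local Open Scope ring_scope.

(** * Jump times and histories of a path *)

Section PathStructure.
Context {R : realType} {V : Type} (adj : rel V) (o : V) (p : R -> V).
Hypothesis hp : nearest_neighbour_path adj o p.

(** The position alone is not Markov, but the list of visited vertices determines the explored
    edges, so the jump rates out of a history are constants. The weight is forced by matching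
    coefficients: under rate one, the weighted probability of a history has diagonal coefficient
    [theta] minus the number of neighbours, and [reinforced_theta] is the difference of the two exit
    rates so that this becomes minus the exit rate for parameter [a]; the factor [rate a] per jump
    turns the incoming rate one into the reinforced one. The definition of the walk speaks only of
    positions at deterministic times, never of holding times, so leaving and entering a history must
    be read off the position at t + h, outside the event of two close jumps. A further obstacle is
    that [tau] may be infinite, where the density is not under control: this event is shown to be
    null, because the probability of staying in a history becomes arbitrarily small when every
    vertex has a neighbour. If some vertex has none, connectedness reduces the graph to one point,
    and the claim is checked directly. *)

Definition jtime (n : nat) : R := fine (tau p n).

Definition jumps_at (n : nat) (t : R) : Prop :=
  (tau p n <= t%:E)%E /\ (t%:E < tau p n.+1)%E.

Lemma path_right_const t : 0 <= t ->
  exists2 d : R, 0 < d & forall u, t <= u -> u < t + d -> p u = p t.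
Proof.
case: hp => _ hr _ /hr [d /= d0 h].
exists d => // u; rewrite le_eqVlt => /predU1P[<- //|tu ud].
by apply: h => //=; rewrite distrC ger0_norm ?subr_ge0 ?(ltW tu)// ltrBlDl.
Qed.

Lemma left_valueP s x : left_value p s x ->
  exists2 d : R, 0 < d & forall u, s - d < u -> u < s -> p u = x.
Proof.
move=> [d /= d0 h]; exists d => // u su us; apply: h => //=.
by rewrite ger0_norm ?subr_ge0 ?(ltW us)// ltrBlDr -ltrBlDl.
Qed.

Lemma left_value_uniq s x y : left_value p s x -> left_value p s y -> x = y.
Proof.
move=> /left_valueP[d d0 h] /left_valueP[e e0 k].
have m0 : 0 < Num.min d e by rewrite lt_min d0.
have [md me] : Num.min d e <= d /\ Num.min d e <= e.
  by rewrite !ge_min !lexx orbT.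
by rewrite -(h (s - Num.min d e / 2)) -?(k (s - Num.min d e / 2))//; lra.
Qed.

Lemma left_valueI s x d : 0 < d -> (forall u, s - d < u -> u < s -> p u = x) ->
  left_value p s x.
Proof.
move=> d0 h; exists d => //= u /=; rewrite ltr_norml => /andP[_ sd] us.
by apply: h => //; rewrite ltrBlDr -ltrBlDl.
Qed.

Lemma tauS n : tau p n.+1 = ereal_inf [set t%:E | t in
  [set t : R | (tau p n < t%:E)%E /\ p t <> p (jtime n)]].
Proof. by []. Qed.

Lemma tau_geS n : (tau p n <= tau p n.+1)%E.
Proof.
by rewrite tauS; apply: le_ereal_inf_tmp => _ [t [nt _] <-]; exact: ltW.
Qed.

Lemma tau_le m n : (m <= n)%N -> (tau p m <= tau p n)%E.
Proof.
elim: n => [|n IH]; first by rewrite leqn0 => /eqP ->.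
rewrite leq_eqVlt => /predU1P[-> //|]; rewrite ltnS => /IH h.
exact: le_trans h (tau_geS _).
Qed.

Lemma tau_ge0 n : (0 <= tau p n)%E.
Proof. exact: (@tau_le 0). Qed.

Lemma jtimeE n t : (tau p n <= t%:E)%E -> tau p n = (jtime n)%:E.
Proof.
move=> h; rewrite /jtime fineK//.
rewrite fin_numE; apply/andP; split.
  by rewrite -ltNye (lt_le_trans _ (tau_ge0 n)) ?ltNy0.
by rewrite -ltey (le_lt_trans h) ?ltry.
Qed.

Lemma jtime_ge0 n : 0 <= jtime n.
Proof. by rewrite /jtime fine_ge0 ?tau_ge0. Qed.

Lemma jtime0 : jtime 0 = 0. Proof. by []. Qed.

(** Right-continuity keeps the path at its value for a positive time after the jump. *)
Lemma tau_gtS n t : (tau p n <= t%:E)%E -> (tau p n < tau p n.+1)%E.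
Proof.
move=> nt; have [d d0 h] := path_right_const (jtime_ge0 n).
apply: (@lt_le_trans _ _ (jtime n + d)%:E).
  by rewrite (jtimeE nt) lte_fin ltrDl.
rewrite tauS; apply: le_ereal_inf_tmp => _ [u [nu pu] <-].
rewrite lee_fin leNgt; apply/negP => ud; apply: pu; apply: h => //.
by move: nu; rewrite (jtimeE nt) lte_fin => /ltW.
Qed.

Lemma const_after n t u : (tau p n <= t%:E)%E ->
  jtime n <= u -> (u%:E < tau p n.+1)%E -> p u = p (jtime n).
Proof.
move=> nt nu; apply: contraPP => pu; apply/negP; rewrite -leNgt.
rewrite tauS; apply: ereal_inf_lbound; exists u => //; split => //.
rewrite (jtimeE nt) lte_fin lt_neqAle nu andbT.
by apply/eqP => e; apply: pu; rewrite e.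
Qed.

Lemma jump_left n t : (tau p n.+1 <= t%:E)%E ->
  left_value p (jtime n.+1) (p (jtime n)).
Proof.
move=> nt; have nt' := le_trans (tau_geS n) nt.
have := tau_gtS nt'; rewrite (jtimeE nt') (jtimeE nt) lte_fin => lt.
apply: (@left_valueI _ _ (jtime n.+1 - jtime n)); first by rewrite subr_gt0.
move=> u u1 u2; apply: (@const_after n t u) => //; first by lra.
by rewrite (jtimeE nt) lte_fin.
Qed.

(** The infimum defining [tau p n.+1] is attained: were the value there still the old one,
    right-continuity would prolong it and push the infimum further. *)
Lemma jump_neq n t : (tau p n.+1 <= t%:E)%E -> p (jtime n) <> p (jtime n.+1).
Proof.
move=> nt e; have nt' := le_trans (tau_geS n) nt.
have [d d0 h] := path_right_const (jtime_ge0 n.+1).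
have : ((jtime n.+1 + d)%:E <= tau p n.+1)%E; last first.
  by rewrite (jtimeE nt) lee_fin; lra.
rewrite tauS; apply: le_ereal_inf_tmp => _ [u [nu pu] <-].
rewrite lee_fin leNgt; apply/negP => ud; apply: pu.
rewrite (jtimeE nt') lte_fin in nu.
have [u1|u1] := leP (jtime n.+1) u; first by rewrite h.
by apply: (@const_after n t) => //; rewrite ?(ltW nu)// (jtimeE nt) lte_fin.
Qed.

Lemma jump_adj n t : (tau p n.+1 <= t%:E)%E -> adj (p (jtime n)) (p (jtime n.+1)).
Proof.
move=> nt; have nt' := le_trans (tau_geS n) nt.
have := tau_gtS nt'; rewrite (jtimeE nt') (jtimeE nt) lte_fin => lt.
case: hp => _ _ /(_ (jtime n.+1)) [|x hx].
  exact: le_lt_trans (jtime_ge0 n) lt.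
rewrite (left_value_uniq hx (jump_left nt)) => -[e|//].
by have := jump_neq nt; rewrite e.
Qed.

(** No explosion. If all jump times were at most [t], the path would have a left limit in the
    discrete space [V] at their supremum, hence be constant just before it, while two consecutive
    jump times there carry distinct values. *)
Lemma jumps_at_exists t : 0 <= t -> exists n, jumps_at n t.
Proof.
move=> t0; apply: contrapT => /forallNP h.
have le n : (tau p n <= t%:E)%E.
  elim: n => [|n IH]; first by rewrite /= lee_fin.
  by rewrite leNgt; apply/negP => lt; apply: (h n).
have lt n : jtime n < jtime n.+1.
  by have := tau_gtS (le n); rewrite !(jtimeE (le _)) lte_fin.
pose E := range jtime.
have sE : has_sup E.
  split; first by exists (jtime 0); exists 0%N.
  by exists t => _ [n _ <-]; have := le n; rewrite (jtimeE (le n)) lee_fin.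
have ub n : jtime n <= sup E by apply: sup_upper_bound => //; exists n.
have L0 : 0 < sup E by apply: lt_le_trans (ub 1%N); exact: (lt 0%N).
case: hp => _ _ /(_ _ L0) [x /left_valueP[d d0 hd] _].
have [_ [n _ <-] ns] := sup_adherent d0 sE.
apply: (jump_neq (le n.+1)); rewrite !hd//.
- exact: lt_trans ns (lt n).
- exact: lt_le_trans (lt _) (ub _).
- exact: lt_le_trans (lt _) (ub _).
Qed.

Lemma jumps_at_uniq m n t : jumps_at m t -> jumps_at n t -> m = n.
Proof.
move=> [m1 m2] [n1 n2]; apply/eqP; rewrite eqn_leq; apply/andP; split.
  rewrite leqNgt; apply/negP => /tau_le mn.
  by have := lt_le_trans n2 (le_trans mn m1); rewrite ltxx.
rewrite leqNgt; apply/negP => /tau_le mn.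
by have := lt_le_trans m2 (le_trans mn n1); rewrite ltxx.
Qed.

Lemma jumps_at_val n t : jumps_at n t -> p t = p (jtime n).
Proof.
move=> [h k]; apply: (@const_after n t) => //.
by rewrite -lee_fin -(jtimeE h).
Qed.

(** Between consecutive jump times the path is constant, so a discontinuity at [s] forces the last
    jump time up to [s] to be [s] itself. *)
Lemma jump_timeP s x : 0 < s -> left_value p s x -> x <> p s ->
  exists n, [/\ tau p n.+1 = s%:E, jtime n.+1 = s & x = p (jtime n)].
Proof.
move=> s0 lx xs; have [n [ns sn]] := jumps_at_exists (ltW s0).
have nE := jtimeE ns.
have sE : jtime n = s.
  apply: contrapT => /eqP neq.
  have lt : jtime n < s by rewrite lt_neqAle neq -lee_fin -nE.
  apply: xs; have -> : p s = p (jtime n) by apply: (@const_after n s) => //; exact: ltW.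
  apply: (left_value_uniq lx); apply: (@left_valueI _ _ (s - jtime n)).
    by rewrite subr_gt0.
  move=> u u1 u2; apply: (@const_after n s u) => //; first by lra.
  by apply: lt_trans sn; rewrite lte_fin.
case: n ns sn nE sE => [|n] ns sn nE sE; first by move: s0; rewrite -sE jtime0 ltxx.
exists n; split => //; first by rewrite nE sE.
by apply: (left_value_uniq lx); rewrite -sE; exact: jump_left ns.
Qed.

Lemma jump_timeI n s : tau p n.+1 = s%:E ->
  [/\ 0 < s, left_value p s (p (jtime n)) & p (jtime n) <> p s].
Proof.
move=> e; have ns : (tau p n.+1 <= s%:E)%E by rewrite e.
have js : jtime n.+1 = s by rewrite /jtime e.
have := tau_gtS (le_trans (tau_geS n) ns).
rewrite e (jtimeE (le_trans (tau_geS n) ns)) lte_fin => lt.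
split; first exact: le_lt_trans (jtime_ge0 n) lt.
  by rewrite -js; exact: jump_left ns.
by have := jump_neq ns; rewrite js.
Qed.

Lemma traversesP e s : traverses p e s <->
  exists n, tau p n.+1 = s%:E /\ e = [set p (jtime n); p (jtime n.+1)].
Proof.
split=> [[s0 [x [lx xs ->]]]|[n [ns ->]]].
  by have [n [ns js ->]] := jump_timeP s0 lx xs; exists n; rewrite js.
have [s0 h1 h2] := jump_timeI ns; split => //; exists (p (jtime n)); split => //.
by rewrite /jtime ns.
Qed.

(** Replaces the uncountable choice of two jump times by a choice of index, which makes the event
    measurable. *)
Lemma two_jumpsP t u :
  (exists s1 s2 : R, [/\ t < s1, s1 < s2, s2 < u, jump_time p s1 & jump_time p s2])
  <-> exists n, (t%:E < tau p n.+1)%E /\ (tau p n.+2 < u%:E)%E.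
Proof.
split=> [[s1 [s2 [ts s12 su [s10 [x1 lx1 x1s]] [s20 [x2 lx2 x2s]]]]]|[n [tn nu]]].
  have [n1 [n1s _ _]] := jump_timeP s10 lx1 x1s.
  have [n2 [n2s _ _]] := jump_timeP s20 lx2 x2s.
  have n12 : (n1 < n2)%N.
    rewrite ltnNge; apply/negP; rewrite -ltnS => /tau_le.
    by rewrite n1s n2s lee_fin leNgt s12.
  exists n1; rewrite n1s lte_fin; split => //.
  rewrite -ltnS in n12.
  by apply: le_lt_trans (tau_le n12) _; rewrite n2s lte_fin.
have n2 := ltW nu.
have n1 := le_trans (tau_geS _) n2.
have [s1 h1 k1] := jump_timeI (jtimeE n1).
have [s2 h2 k2] := jump_timeI (jtimeE n2).
exists (jtime n.+1), (jtime n.+2); split.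
- by rewrite -lte_fin -(jtimeE n1).
- by rewrite -lte_fin -(jtimeE n1) -(jtimeE n2); exact: tau_gtS n1.
- by rewrite -lte_fin -(jtimeE n2).
- by split => //; exists (p (jtime n)).
- by split => //; exists (p (jtime n.+1)).
Qed.

(* Latest position first. *)
Fixpoint trace (n : nat) : seq V :=
  p (jtime n) :: (if n is m.+1 then trace m else [::]).

Lemma size_trace n : size (trace n) = n.+1.
Proof. by elim: n => //= n ->. Qed.

Definition history (z : seq V) (t : R) : Prop :=
  exists2 n, z = trace n & jumps_at n t.

Lemma history_uniq z z' t : history z t -> history z' t -> z = z'.
Proof. by move=> [n -> h] [m -> k]; rewrite (jumps_at_uniq h k). Qed.

Lemma history_exists t : 0 <= t -> exists z, history z t.
Proof. by move=> /jumps_at_exists [n h]; exists (trace n); exists n. Qed.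

Lemma history_cons x l t : history (x :: l) t ->
  [/\ p t = x, x :: l = trace (size l) & jumps_at (size l) t].
Proof.
move=> [n e h]; have sz : size l = n by have := size_trace n; rewrite -e => -[].
rewrite sz; split => //; rewrite (jumps_at_val h).
by move: e; case: n {h sz} => [|n] /= [].
Qed.

Lemma history_nil t : ~ history [::] t.
Proof. by move=> [[|n]]. Qed.

End PathStructure.

(** * Explored edges as a function of the history *)

Fixpoint edges_along {V : Type} (z : seq V) : set (set V) :=
  match z with
  | x :: l => match l with y :: _ => [set y; x] |` edges_along l | [::] => set0 end
  | [::] => set0
  end.

Lemma edges_along_trace {R : realType} {V : Type} (p : R -> V) n :
  edges_along (trace p n) =
  [set e | exists2 k, (k < n)%N & e = [set p (jtime p k); p (jtime p k.+1)]].
Proof.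
elim: n => [|n IH]; first by apply/seteqP; split => // e [].
have -> : edges_along (trace p n.+1) =
    [set p (jtime p n); p (jtime p n.+1)] |` edges_along (trace p n).
  by rewrite /=; case: n {IH}.
rewrite IH; apply/seteqP; split => e.
  by move=> [->|[k kn ->]]; [exists n|exists k => //; exact: ltnW].
move=> [k]; rewrite ltnS leq_eqVlt => /predU1P[->|kn] ->; first by left.
by right; exists k.
Qed.

Lemma traversed_edges_trace {R : realType} {V : Type} (adj : rel V) o (p : R -> V)
    (hp : nearest_neighbour_path adj o p) n (T : \bar R) :
  (tau p n <= T)%E -> (T < tau p n.+1)%E ->
  traversed_edges p T = edges_along (trace p n).
Proof.
move=> nT Tn; rewrite edges_along_trace; apply/seteqP; split => e.
  move=> [s [sT /(traversesP hp)[k [ks ->]]]]; exists k => //.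
  rewrite ltnNge; apply/negP => nk.
  have : (T < T)%E by apply: (lt_le_trans Tn); apply: le_trans sT; rewrite -ks; exact: tau_le.
  by rewrite ltxx.
move=> [k kn ->]; exists (jtime p k.+1).
have kT : (tau p k.+1 <= T)%E by apply: le_trans nT; exact: tau_le.
have kf : tau p k.+1 = (jtime p k.+1)%:E.
  rewrite /jtime fineK// fin_numE; apply/andP; split.
    by rewrite -ltNye (lt_le_trans _ (tau_ge0 p _)) ?ltNy0.
  by rewrite -ltey (le_lt_trans kT)// (lt_le_trans Tn) ?leey.
by split; [rewrite -kf|apply/(traversesP hp); exists k].
Qed.

Lemma history_traversed {R : realType} {V : Type} (adj : rel V) o (p : R -> V)
    (hp : nearest_neighbour_path adj o p) z t :
  history p z t -> traversed_edges p t%:E = edges_along z.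
Proof. by move=> [n -> [h k]]; apply: traversed_edges_trace hp _ _ _ _. Qed.

(** * Measurability with respect to the past *)

Lemma countable_seq (V : Type) : countable [set: V] -> countable [set: seq V].
Proof.
move=> /countable_injP[f injf]; apply/countable_injP.
exists (fun l => choice.pickle (map f l : seq nat)) => l l' _ _ /(pcan_inj choice.pickleK) /inj_map; apply.
by move=> x y; apply: injf; rewrite in_setE.
Qed.

(** The balls around the root are countable by induction on the radius, and connectedness makes them
    exhaust [V]. *)
Lemma countable_connected (V : Type) (adj : rel V) (o : V) :
  connected_graph adj -> bounded_degree adj -> countable [set: V].
Proof.
move=> hc [D hD].
pose ball := fix ball n : set V :=
  if n is m.+1 then \bigcup_(x in ball m) [set y | adj x y] else [set o].
have cb n : countable (ball n).
  elim: n => [|n IH] /=; first exact: countable1.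
  apply: bigcup_countable => // x _; apply: sub_countable (hD x) _.
  exact: countableP.
have -> : [set: V] = \bigcup_n ball n.
  apply/seteqP; split => // x _.
  have [q pq <-] := hc o x; exists (size q) => //.
  elim/last_ind: q pq => [//|q y IH]; rewrite rcons_path last_rcons size_rcons.
  by move=> /andP[/IH h a] /=; exists (last o q).
by apply: bigcup_countable => //; exact: countableP.
Qed.

Section Filtration.
Context {R : realType} {V : Type} (adj : rel V) (o : V).
Context {d : measure_display} {Omega : measurableType d} (X : Omega -> R -> V).
Hypothesis hX : nearest_neighbour_process X adj o.
Hypothesis cV : countable [set: V].

(** The generating family of [sigma_upto], repeated verbatim so that membership in
    [sigma_upto X t%:E] and measurability in [past t] are interchangeable by conversion. *)
Definition generators (T : \bar R) : set (set Omega) :=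
  [set A | exists (s : R) (B : set V),
         [/\ 0 <= s, (s%:E <= T)%E & A = [set w | B (X w s)]] ].

(* An alias of [Omega] whose measurable sets are [sigma_upto X t%:E]. *)
Definition past (t : R) : measurableType (sigma_display (generators t%:E)) :=
  g_sigma_algebraType (generators t%:E).

Lemma past_X t s (B : set V) : 0 <= s -> s <= t ->
  (@measurable _ (past t)) [set w | B (X w s)].
Proof.
by move=> s0 st; apply: sub_sigma_algebra; exists s, B; rewrite lee_fin.
Qed.

Lemma past_le s t (A : set Omega) : s <= t ->
  (@measurable _ (past s)) A -> (@measurable _ (past t)) A.
Proof.
move=> st; apply: sub_sigma_algebra2 => _ [u [B [u0 us ->]]]; exists u, B.
by split => //; apply: le_trans us _; rewrite lee_fin.
Qed.

Lemma past_measurable t (A : set Omega) :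
  (@measurable _ (past t)) A -> measurable A.
Proof.
move=> h; apply: (smallest_sub _ _ h); first exact: sigma_algebra_measurable.
by move=> _ [u [B [u0 us ->]]]; exact: hX.1.
Qed.

Lemma sigma_upto_measurable T (A : set Omega) : sigma_upto X T A -> measurable A.
Proof.
move=> h; apply: (smallest_sub _ _ h); first exact: sigma_algebra_measurable.
by move=> _ [u [B [u0 us ->]]]; exact: hX.1.
Qed.

(** Rationals truncated to the interval from 0 to [t]: a countable dense set of sampling times that
    contains the endpoint [t]. *)
Definition clip (t : R) (q : rat) : R := Num.max 0 (Num.min t (ratr q)).

Lemma clip_ge0 t q : 0 <= clip t q. Proof. by rewrite le_max lexx. Qed.

Lemma clip_le t q : 0 <= t -> clip t q <= t.
Proof. by move=> t0; rewrite ge_max t0 ge_min lexx. Qed.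


(** When [b] lies beyond [t] the endpoint [t] is itself a sample; this covers a jump occurring
    exactly at [t]. *)
Lemma clip_dense t a (b : \bar R) : 0 <= a -> a <= t -> (a%:E < b)%E ->
  exists2 q, a <= clip t q & ((clip t q)%:E < b)%E.
Proof.
move=> a0 at_ ab; have t0 := le_trans a0 at_.
have [tb|bt] := ltP t%:E b.
  have /rat_in_itvoo[q] : t < t + 1 by rewrite ltrDl.
  rewrite in_itv /= => /andP[tq _]; exists q.
    by rewrite /clip (min_l (ltW tq)) (max_r t0).
  by apply: le_lt_trans tb; rewrite lee_fin clip_le.
case: b ab bt => [b| |] //; rewrite !lee_fin !lte_fin => ab bt.
have /rat_in_itvoo[q] := ab; rewrite in_itv /= => /andP[aq qb]; exists q.
  by rewrite /clip le_max le_min (ltW aq) at_ orbT.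
rewrite lte_fin /clip gt_max gt_min qb orbT andbT.
exact: le_lt_trans a0 ab.
Qed.

Lemma history_at w n t : (tau (X w) n <= t%:E)%E ->
  exists q, [/\ jtime (X w) n <= clip t q, jumps_at (X w) n (clip t q) &
                X w (clip t q) = X w (jtime (X w) n)].
Proof.
move=> nt; have nE := jtimeE nt.
have [||q h k] := @clip_dense t (jtime (X w) n) (tau (X w) n.+1) (jtime_ge0 _ _).
- by rewrite -lee_fin -nE.
- by rewrite -nE; exact: (tau_gtS (hX.2 w) nt).
have J : jumps_at (X w) n (clip t q) by split => //; rewrite nE lee_fin.
by exists q; split => //; exact: (jumps_at_val J).
Qed.

Lemma jumps_at_le w m n s t : jumps_at (X w) m s -> jumps_at (X w) n t ->
  s <= t -> (m <= n)%N.
Proof.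
move=> [ms sm] [nt tn] st; rewrite leqNgt; apply/negP => nm.
have := lt_le_trans tn (tau_le (X w) nm).
by move=> /lt_le_trans/(_ ms); rewrite lte_fin ltNge st.
Qed.

(** Each holding interval that starts by time [t] contains a sampling time, so the next jump is
    detected by seeing a history with [n] jumps and later a position off its last vertex. *)
Lemma tauS_leP w n t : 0 <= t -> (tau (X w) n.+1 <= t%:E)%E <->
  exists q q' x l, [/\ clip t q <= clip t q', size l = n,
     history (X w) (x :: l) (clip t q) & X w (clip t q') <> x].
Proof.
move=> t0; split=> [nt|[q [q' [x [l [qq' sl h neq]]]]]].
  have [q [q1 q2 q3]] := history_at (le_trans (tau_geS _ _) nt).
  have [q' [q1' q2' q3']] := history_at nt.
  have [x [l e]] : exists x l, trace (X w) n = x :: l.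
    by case: n {nt q1 q2 q3 q1' q2' q3'} => [|n]; do 2 eexists.
  have sl : size l = n by have := size_trace (X w) n; rewrite e => -[].
  have ex : x = X w (jtime (X w) n).
    by move: e; case: n {nt q1 q2 q3 q1' q2' q3' sl} => [|n] [].
  exists q, q', x, l; split => //; last first.
    by rewrite q3' ex => /esym; exact: (jump_neq (hX.2 w) nt).
    by exists n.
  apply: ltW; apply: lt_le_trans q1'.
  by rewrite -lte_fin -(jtimeE nt); exact: q2.2.
have [h1 h2 [h3 h4]] := history_cons h; rewrite sl in h3 h4.
apply: (@le_trans _ _ (clip t q')%:E); last by rewrite lee_fin clip_le.
rewrite leNgt; apply/negP => q'n; apply: neq; rewrite -h1.
rewrite (const_after h3 _ q'n); last first.
  by apply: le_trans qq'; rewrite -lee_fin -(jtimeE h3).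
rewrite -(const_after h3 _ h4)//.
by rewrite -lee_fin -(jtimeE h3).
Qed.

Lemma history1P w x t : 0 <= t -> history (X w) [:: x] t <->
  X w 0 = x /\ ~ exists q, X w (clip t q) <> x.
Proof.
move=> t0; split=> [h|[h1 h2]].
  have [e1 [e2] [h1 h2]] := history_cons h.
  split; first by rewrite e2.
  move=> [q]; apply; rewrite (const_after h1 (clip_ge0 _ _)) ?e2//.
  by apply: le_lt_trans h2; rewrite lee_fin clip_le.
exists 0%N; first by rewrite /= -h1.
split => //; rewrite ltNge; apply/negP => t1; apply: h2.
have [q [_ _ e]] := history_at t1; exists q; rewrite e -h1 => /esym.
exact: (jump_neq (hX.2 w) t1).
Qed.

(** Being at [x] after the history [y :: l] leaves open whether further jumps occurred and the path
    came back. The forbidden triple of samples (history [y :: l], then off [y], then off [x])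
    excludes exactly this, and mentions only shorter histories and positions. *)
Lemma history2P w x y l t : 0 <= t -> history (X w) (x :: y :: l) t <->
  [/\ x <> y, X w t = x, exists q, history (X w) (y :: l) (clip t q) &
   ~ exists q q' q'', [/\ clip t q <= clip t q', clip t q' <= clip t q'',
      history (X w) (y :: l) (clip t q), X w (clip t q') <> y &
      X w (clip t q'') <> x]].
Proof.
move=> t0; split=> [h|[xy tx [q hq] H]].
  have [e1 e2 [h1 h2]] := history_cons h.
  have [e3 e4] : x = X w (jtime (X w) (size l).+1) /\ y :: l = trace (X w) (size l).
    by case: e2 => -> ->.
  have e5 : y = X w (jtime (X w) (size l)) by case: (size l) e4 => [|?] [].
  split => //.
  - by rewrite e3 e5 => /esym; exact: (jump_neq (hX.2 w) h1).
  - have [q [_ q1 _]] := history_at (le_trans (tau_geS _ _) h1).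
    by exists q; exists (size l).
  move=> [q [q' [q'' [qq' qq'' hq nq' nq'']]]]; apply: nq''.
  have [_ _ [k1 k2]] := history_cons hq.
  have q'1 : jtime (X w) (size l).+1 <= clip t q'.
    rewrite leNgt; apply/negP => lt; apply: nq'.
    rewrite (const_after k1) ?e5//.
      by apply: le_trans qq'; rewrite -lee_fin -(jtimeE k1).
    by rewrite (jtimeE h1) lte_fin.
  rewrite (const_after h1 (le_trans q'1 qq'')) ?e3//.
  by apply: le_lt_trans h2; rewrite lee_fin clip_le.
have [e1 e2 k] := history_cons hq.
have [m mt] := jumps_at_exists (hX.2 w) t0.
have e5 : y = X w (jtime (X w) (size l)) by case: (size l) e2 => [|?] [].
have lm : (size l <= m)%N by apply: jumps_at_le k mt _; exact: clip_le.
have lt : (tau (X w) (size l).+1 <= t%:E)%E.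
  rewrite leNgt; apply/negP => tl; apply: xy; rewrite -tx e5.
  apply: (const_after k.1 _ tl); apply: le_trans (clip_le q t0).
  by rewrite -lee_fin -(jtimeE k.1) k.1.
have [q' [q1' q2' q3']] := history_at lt.
have qq' : clip t q <= clip t q'.
  by apply: ltW; apply: lt_le_trans q1'; rewrite -lte_fin -(jtimeE lt); exact: k.2.
have yq' : X w (clip t q') <> y.
  by rewrite q3' e5 => /esym; exact: (jump_neq (hX.2 w) lt).
have tl2 : (t%:E < tau (X w) (size l).+2)%E.
  rewrite ltNge; apply/negP => lt2; apply: H.
  (* If the first vertex after [y] is not [x], the same sample witnesses both having left [y] and
     being off [x]. *)
  have [xq'|xq'] := pselect (X w (clip t q') = x); last by exists q, q', q'; split.
  have [q'' [q1'' q2'' q3'']] := history_at lt2.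
  exists q, q', q''; split => //.
    apply: ltW; apply: lt_le_trans q1''.
    by rewrite -lte_fin -(jtimeE lt2); exact: q2'.2.
  by rewrite q3'' -xq' q3' => /esym; exact: (jump_neq (hX.2 w) lt2).
exists (size l).+1; last by [].
have J : jumps_at (X w) (size l).+1 t by [].
by rewrite /= -e2 -tx (jumps_at_val J).
Qed.

Lemma bigcup_rat_past t (F : rat -> set Omega) :
  (forall q, (@measurable _ (past t)) (F q)) ->
  (@measurable _ (past t)) (\bigcup_q F q).
Proof. exact: (@bigcupT_measurable_rat _ (past t)). Qed.

(** Induction on the history: the sampled descriptions involve countable unions and complements of
    events at times up to [t]. *)
Lemma past_history z t : 0 <= t ->
  (@measurable _ (past t)) [set w | history (X w) z t].
Proof.
elim: z t => [|x [|y l] IH] t t0.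
- rewrite (_ : [set _ | _] = set0); first exact: (@measurable0 _ (past t)).
  by apply/seteqP; split => // w /history_nil.
- rewrite (_ : [set _ | _] = [set w | X w 0 = x] `\`
      \bigcup_q [set w | X w (clip t q) <> x]); last first.
    apply/seteqP; split => w /=.
      move=> /(history1P _ _ t0)[h1 h2]; split => // -[q _ hq].
      by apply: h2; exists q.
    move=> [h1 h2]; apply/(history1P _ _ t0); split => // -[q hq].
    by apply: h2; exists q.
  apply: (@measurableD _ (past t)); first exact: (past_X [set x]).
  apply: bigcup_rat_past => q.
  by apply: (past_X [set y | y <> x]); [exact: clip_ge0|exact: clip_le].
have [xy|xy] := pselect (x = y).
  rewrite (_ : [set _ | _] = set0); first exact: (@measurable0 _ (past t)).
  by apply/seteqP; split => // w /= /(history2P _ _ _ _ t0)[].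
rewrite (_ : [set _ | _] = [set w | X w t = x] `&`
   (\bigcup_q [set w | history (X w) (y :: l) (clip t q)]) `\`
   (\bigcup_q \bigcup_q' \bigcup_q''
     ([set w | clip t q <= clip t q' /\ clip t q' <= clip t q''] `&`
      [set w | history (X w) (y :: l) (clip t q)] `&`
      [set w | X w (clip t q') <> y] `&` [set w | X w (clip t q'') <> x])));
   last first.
  apply/seteqP; split => w /=.
    move=> /(history2P _ _ _ _ t0)[_ h1 [q h2] h3]; split.
      by split => //; exists q.
    move=> [q0 _ [q' _ [q'' _ [[[[k1 k2] k3] k4] k5]]]].
    by apply: h3; exists q0, q', q''.
  move=> [[h1 [q _ h2]] h3]; apply/(history2P _ _ _ _ t0); split => //.
    by exists q.
  move=> [q0 [q' [q'' [k1 k2 k3 k4 k5]]]].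
  by apply: h3; exists q0 => //; exists q' => //; exists q''.
have mh q : (@measurable _ (past t)) [set w | history (X w) (y :: l) (clip t q)].
  by apply: (past_le (clip_le q t0)); apply: IH; exact: clip_ge0.
have mx x' q : (@measurable _ (past t)) [set w | X w (clip t q) <> x'].
  by apply: (past_X [set y | y <> x']); [exact: clip_ge0|exact: clip_le].
apply: (@measurableD _ (past t)).
  apply: (@measurableI _ (past t)); first exact: (past_X [set x]).
  exact: bigcup_rat_past.
apply: bigcup_rat_past => q; apply: bigcup_rat_past => q'.
apply: bigcup_rat_past => q''; do 3! apply: (@measurableI _ (past t)) => //.
have [c|c] := pselect (clip t q <= clip t q' /\ clip t q' <= clip t q'').
  rewrite (_ : [set _ | _] = setT); first exact: (@measurableT _ (past t)).
  by apply/seteqP; split.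
rewrite (_ : [set _ | _] = set0); first exact: (@measurable0 _ (past t)).
by apply/seteqP; split => // w -[].
Qed.

Lemma past_tau n t : 0 <= t ->
  (@measurable _ (past t)) [set w | (tau (X w) n <= t%:E)%E].
Proof.
case: n => [|n] t0.
  rewrite (_ : [set _ | _] = setT); first exact: (@measurableT _ (past t)).
  by apply/seteqP; split => // w _ /=; rewrite lee_fin.
rewrite (_ : [set _ | _] = \bigcup_q \bigcup_q' \bigcup_l
   ([set w | [/\ clip t q <= clip t q' & size l = n.+1]] `&`
    [set w | history (X w) l (clip t q)] `&`
    [set w | if l is x :: _ then X w (clip t q') <> x else False])); last first.
  apply/seteqP; split => w /=.
    move=> /(tauS_leP _ _ t0)[q [q' [x [l [h1 h2 h3 h4]]]]].
    by exists q => //; exists q' => //; exists (x :: l) => //=; rewrite h2.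
  move=> [q _ [q' _ [[|x l] _ [[[h1 h2] h3] h4]]]] //.
  apply/(tauS_leP _ _ t0); exists q, q', x, l; split => //.
  by case: h2.
apply: bigcup_rat_past => q; apply: bigcup_rat_past => q'.
apply: (@countable_bigcupT_measurable _ (past t)) => [|l]; first exact: countable_seq.
apply: (@measurableI _ (past t)); first apply: (@measurableI _ (past t)).
- have [c|c] := pselect (clip t q <= clip t q' /\ size l = n.+1).
    rewrite (_ : [set _ | _] = setT); first exact: (@measurableT _ (past t)).
    by apply/seteqP; split.
  rewrite (_ : [set _ | _] = set0); first exact: (@measurable0 _ (past t)).
  by apply/seteqP; split.
- by apply: (past_le (clip_le q t0)); apply: past_history; exact: clip_ge0.
case: l => [|x l].
  rewrite (_ : [set _ | _] = set0); first exact: (@measurable0 _ (past t)).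
  by apply/seteqP; split.
by apply: (past_X [set y | y <> x]); [exact: clip_ge0|exact: clip_le].
Qed.

Definition stopped_tau (n : nat) (t : R) (w : Omega) : R :=
  fine (Order.min (tau (X w) n) t%:E).

Lemma stopped_tauE n t w : 0 <= t ->
  (stopped_tau n t w)%:E = Order.min (tau (X w) n) t%:E.
Proof.
move=> t0; rewrite /stopped_tau fineK// fin_numE; apply/andP; split.
  by rewrite -ltNye lt_min (lt_le_trans _ (tau_ge0 _ _)) ?ltNyr// ltNy0.
by rewrite -ltey gt_min ltry orbT.
Qed.

Lemma stopped_tau_ge0 n t w : 0 <= t -> 0 <= stopped_tau n t w.
Proof. by move=> t0; rewrite -lee_fin stopped_tauE// le_min tau_ge0 lee_fin. Qed.

Lemma stopped_tau_le n t w : 0 <= t -> stopped_tau n t w <= t.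
Proof. by move=> t0; rewrite -lee_fin stopped_tauE// ge_min lexx orbT. Qed.

Lemma stopped_tau_leS n t w : 0 <= t -> stopped_tau n t w <= stopped_tau n.+1 t w.
Proof.
move=> t0; rewrite -lee_fin !stopped_tauE// le_min !ge_min lexx orbT andbT.
by rewrite tau_geS.
Qed.

Lemma stopped_tau_before n t w : 0 <= t -> (tau (X w) n <= t%:E)%E ->
  stopped_tau n t w = jtime (X w) n.
Proof. by move=> t0 h; rewrite /stopped_tau min_l. Qed.

Lemma stopped_tau_after n t w : 0 <= t -> (t%:E <= tau (X w) n)%E ->
  stopped_tau n t w = t.
Proof. by move=> t0 h; rewrite /stopped_tau min_r. Qed.

Lemma measurable_stopped_tau n t : 0 <= t ->
  measurable_fun (setT : set (past t)) (stopped_tau n t : past t -> R).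
Proof.
move=> t0; apply: (measurability _ (RGenOInfty.measurableE R)).
move=> _ [_ [x ->] <-]; rewrite setTI.
have [x0|x0] := ltP x 0.
  rewrite (_ : _ @^-1` _ = setT); first exact: (@measurableT _ (past t)).
  apply/seteqP; split => // w _; rewrite /= in_itv /= andbT.
  by apply: lt_le_trans x0 _; exact: stopped_tau_ge0.
have [tx|xt] := leP t x.
  rewrite (_ : _ @^-1` _ = set0); first exact: (@measurable0 _ (past t)).
  apply/seteqP; split => // w; rewrite /= in_itv /= andbT ltNge => /negP; apply.
  by apply: le_trans tx; exact: stopped_tau_le.
(* Only levels below [t] matter here, and for them exceeding [x] is decided already in the past of
   [x]. *)
rewrite (_ : _ @^-1` _ = ~` [set w | (tau (X w) n <= x%:E)%E]); last first.
  apply/seteqP; split => w; rewrite /= in_itv /= andbT -lte_fin stopped_tauE//;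
    rewrite lt_min lte_fin xt andbT; by rewrite ltNge => /negP.
apply: (@measurableC _ (past t)).
by apply: (past_le (ltW xt)); exact: past_tau.
Qed.

Lemma past_tau_lt n t : 0 <= t ->
  (@measurable _ (past t)) [set w | (tau (X w) n < t%:E)%E].
Proof.
move=> t0; rewrite (_ : [set _ | _] =
    [set w | (tau (X w) n <= t%:E)%E] `&` ((stopped_tau n t) @^-1` `]-oo, t[)).
  apply: (@measurableI _ (past t)); first exact: past_tau.
  rewrite -[X in measurable X]setTI.
  exact: (measurable_stopped_tau n t0).
apply/seteqP; split => w /=; rewrite in_itv /= -lte_fin stopped_tauE// gt_min ltxx orbF.
  by move=> h; split => //; exact: ltW.
by case.
Qed.

Lemma measurable_two_jumps t u :
  measurable [set w | exists s1 s2 : R,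
     [/\ t < s1, s1 < s2, s2 < u, jump_time (X w) s1 & jump_time (X w) s2]].
Proof.
rewrite (_ : [set _ | _] = \bigcup_n
   ([set w | (t%:E < tau (X w) n.+1)%E] `&` [set w | (tau (X w) n.+2 < u%:E)%E])).
  apply: bigcupT_measurable => n; apply: measurableI.
    have [t0|t0] := ltP t 0.
      rewrite (_ : [set _ | _] = setT)//; apply/seteqP; split => // w _ /=.
      by apply: lt_le_trans (tau_ge0 (X w) n.+1); rewrite lte_fin.
    rewrite (_ : [set _ | _] = ~` [set w | (tau (X w) n.+1 <= t%:E)%E]).
      by apply/measurableC/(@past_measurable t); exact: past_tau.
    by apply/seteqP; split => w /=; rewrite ltNge => /negP.
  have [u0|u0] := ltP u 0.
    rewrite (_ : [set _ | _] = set0)//; apply/seteqP; split => // w /=.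
    move=> h; have := le_lt_trans (tau_ge0 (X w) n.+2) h; rewrite lte_fin => /(lt_trans u0).
    by rewrite ltxx.
  by apply: (@past_measurable u); exact: past_tau_lt.
apply/seteqP; split => w /=.
  by move=> /(two_jumpsP (hX.2 w))[n []]; exists n.
by move=> [n _ [h1 h2]]; apply/(two_jumpsP (hX.2 w)); exists n.
Qed.

End Filtration.

(** * Errors of order o(h) *)

Section Negligible.
Context {R : realType}.
Implicit Types eps : R -> R.

(** One-sided o(h): errors appear only as upper bounds, so no absolute value has to be carried
    along. *)
Definition le_small eps : Prop := forall e : R, 0 < e ->
  exists2 d : R, 0 < d & forall h, 0 < h -> h < d -> eps h <= e * h.

Lemma little_o_small eps : little_o_at0 eps -> le_small (fun h => `|eps h|).
Proof.
move=> /cvgr0Pnorm_lt heps e /heps [d /= d0 hd]; exists d => // h h0 hlt.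
have := hd h; rewrite /= sub0r normrN gtr0_norm// => /(_ hlt h0).
by rewrite normrM normfV (gtr0_norm h0) ltr_pdivrMr// => /ltW.
Qed.

Lemma smallD eps1 eps2 : le_small eps1 -> le_small eps2 ->
  le_small (fun h => eps1 h + eps2 h).
Proof.
move=> h1 h2 e e0; have e2 : 0 < e / 2 by rewrite divr_gt0.
have [d1 d10 k1] := h1 _ e2; have [d2 d20 k2] := h2 _ e2.
exists (Num.min d1 d2); first by rewrite lt_min d10.
move=> h h0; rewrite lt_min => /andP[hd1 hd2].
have := k1 h h0 hd1; have := k2 h h0 hd2; lra.
Qed.

Lemma smallZ c eps : 0 <= c -> le_small eps -> le_small (fun h => c * eps h).
Proof.
move=> c0 he e e0; have c1 : 0 < c + 1 by lra.
have [|d d0 k] := he (e / (c + 1)); first by rewrite divr_gt0.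
exists d => // h h0 hd; have kh := k h h0 hd.
apply: (@le_trans _ _ (c * (e / (c + 1) * h))); first exact: ler_wpM2l.
rewrite mulrA ler_wpM2r ?(ltW h0)// mulrCA ger_pMr//.
by rewrite ler_pdivrMr//; lra.
Qed.

Lemma small_sum (I : Type) (s : seq I) (eps : I -> R -> R) :
  (forall i, le_small (eps i)) -> le_small (fun h => \sum_(i <- s) eps i h).
Proof.
move=> he; elim: s => [|i s IH].
  by move=> e e0; exists 1 => // h h0 _; rewrite big_nil mulr_ge0 ?ltW.
have := smallD (he i) IH; move=> k e e0.
by have [d d0 hd] := k e e0; exists d => // h h0 hlt; rewrite big_cons; exact: hd.
Qed.

Lemma small_sqr c : 0 <= c -> le_small (fun h => c * h ^+ 2).
Proof.
move=> c0; apply: (@smallZ c (fun h => h ^+ 2) c0) => e e0; exists e => // h h0 he.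
by rewrite expr2 ler_wpM2r// ltW.
Qed.

Lemma small_double eps : le_small eps -> le_small (fun h => eps (2 * h)).
Proof.
move=> he e e0; have [|d d0 k] := he (e / 2); first by rewrite divr_gt0.
exists (d / 2); first by rewrite divr_gt0.
by move=> h h0 hd; have := k (2 * h); lra.
Qed.

Lemma small_mulh eps : le_small eps -> le_small (fun h => h * eps h).
Proof.
move=> he e e0; have [d d0 k] := he e e0; exists (Num.min d 1).
  by rewrite lt_min d0 ltr01.
move=> h h0; rewrite lt_min => /andP[hd h1].
apply: (@le_trans _ _ (h * (e * h))).
  by rewrite ler_wpM2l ?(ltW h0)// k.
by rewrite ger_pMl ?mulr_gt0// ltW.
Qed.

(** Cut the interval into N equal steps of length h; the errors add up to at most N times e h / (T -
    s), that is e. Only forward increments are used, so no continuity of [D] in time has to be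
    known. *)
Lemma gronwall0 (D : R -> R) (s T h0 : R) eps : s <= T -> 0 < h0 ->
  D s = 0 -> le_small eps ->
  (forall t h, s <= t -> 0 < h -> h < h0 -> t + h <= T ->
     `|D (t + h)| <= `|D t| + eps h) ->
  D T = 0.
Proof.
move=> sT h00 Ds he step; have [<-//|neq] := eqVneq s T.
have {neq}sT : 0 < T - s by rewrite subr_gt0 lt_neqAle neq.
apply/eqP; rewrite -normr_eq0 eq_le normr_ge0 andbT; apply/ler_addgt0Pr => e e0.
rewrite add0r; have [|d d0 k] := he (e / (T - s)); first by rewrite divr_gt0.
(* The successor of the truncation makes the step strictly smaller than both thresholds. *)
pose N := (Num.truncn ((T - s) / Num.min h0 d)).+1.
have N0 : 0 < N%:R :> R by rewrite ltr0n.
pose h := (T - s) / N%:R.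
have hp : 0 < h by rewrite divr_gt0.
have : h < Num.min h0 d.
  have m0 : 0 < Num.min h0 d by rewrite lt_min h00.
  rewrite /h ltr_pdivrMr// mulrC -ltr_pdivrMr// /N.
  exact: truncnS_gt.
rewrite lt_min => /andP[hh0 hd].
have Nh : N%:R * h = T - s by rewrite /h mulrC divfK ?gt_eqF.
have TE : T = s + N%:R * h by rewrite Nh; lra.
have ind j : (j <= N)%N -> `|D (s + j%:R * h)| <= j%:R * (e / (T - s) * h).
  elim: j => [|j IH] jN; first by rewrite !mul0r addr0 Ds normr0.
  rewrite -natr1 !mulrDl !mul1r addrA.
  apply: le_trans (step _ _ _ hp hh0 _) _.
  - by rewrite lerDl mulr_ge0 // ltW.
  - rewrite TE -addrA lerD2l -{2}[h]mul1r -mulrDl ler_wpM2r ?(ltW hp)//.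
    by rewrite natr1 ler_nat.
  by apply: lerD; [exact/IH/ltnW|exact: k].
rewrite {1}TE; apply: le_trans (ind N (leqnn _)) _.
by rewrite mulrCA Nh divfK ?gt_eqF.
Qed.

(** If [q] stayed above [c], every step of a fixed length h would lower it by at least r c h / 2,
    and it would become negative. *)
Lemma decay (q : R -> R) (s r h0 : R) eps : 0 < r -> 0 < h0 -> le_small eps ->
  (forall t, s <= t -> 0 <= q t) ->
  (forall t h, s <= t -> 0 < h -> h < h0 -> q (t + h) <= (1 - r * h) * q t + eps h) ->
  forall c, 0 < c -> exists2 t, s <= t & q t < c.
Proof.
move=> r0 h00 he q0 step c c0; apply: contrapT => H.
have {}H t : s <= t -> c <= q t.
  by move=> st; rewrite leNgt; apply/negP => lt; apply: H; exists t.
(* This tolerance spends half of the loss r c h on the error. *)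
have [|d d0 k] := he (r * c / 2); first by rewrite divr_gt0 ?mulr_gt0.
pose h := Num.min d h0 / 2.
have m0 : 0 < Num.min d h0 by rewrite lt_min d0 h00.
have hp : 0 < h by rewrite divr_gt0.
have [hd h1] : h < d /\ h < h0.
  have : Num.min d h0 <= d /\ Num.min d h0 <= h0 by rewrite !ge_min !lexx orbT.
  by rewrite /h; lra.
have rch : 0 < r * c * h / 2 by rewrite divr_gt0 ?mulr_gt0.
have ind (j : nat) : q (s + j%:R * h) <= q s - j%:R * (r * c * h / 2).
  elim: j => [|j IH]; first by rewrite !mul0r addr0 subr0.
  have sj : s <= s + j%:R * h by rewrite lerDl mulr_ge0// ltW.
  rewrite -natr1 !mulrDl !mul1r addrA opprD addrA.
  apply: le_trans (step _ _ sj hp h1) _.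
  have := k h hp hd; have := H _ sj; have : 0 < r * h by rewrite mulr_gt0.
  nra.
pose N := (Num.truncn (q s / (r * c * h / 2))).+1.
have lt : q s / (r * c * h / 2) < N%:R by rewrite truncnS_gt.
rewrite ltr_pdivrMr// in lt.
have := q0 (s + N%:R * h); have := ind N.
have : s <= s + N%:R * h by rewrite lerDl mulr_ge0// ltW.
move=> sN a /(_ sN) b; have := le_trans b a; lra.
Qed.

Lemma le_of_inv (a b c : R) : (forall m : nat, a <= b + c / m.+1%:R) -> a <= b.
Proof.
move=> h; apply/ler_addgt0Pr => e e0.
pose m := Num.truncn (`|c| / e).
apply: le_trans (h m) _; rewrite lerD2l ler_pdivrMr ?ltr0n//.
apply: le_trans (ler_norm c) _; rewrite mulrC -ler_pdivrMr//.
by rewrite ltW// truncnS_gt.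
Qed.

(** Both bounds come from 1 + y <= exp y, taken at [x] and at [- x]; the latter gives exp x (1 - x)
    <= 1. *)
Lemma expR_taylor1 (x : R) : `|x| <= 2^-1 ->
  0 <= expR x - 1 - x /\ expR x - 1 - x <= 2 * x ^+ 2.
Proof.
rewrite ler_norml => /andP[x1 x2]; split.
  by have := expR_ge1Dx x; lra.
have : expR x * (1 - x) <= 1.
  rewrite -[leRHS](expRxMexpNx_1 x) ler_wpM2l ?expR_ge0//.
  by have := expR_ge1Dx (- x); lra.
have := expR_gt0 x; nra.
Qed.

Lemma expR_lip (x c : R) : `|x| <= c -> c <= 2^-1 -> `|expR x - 1| <= 2 * c.
Proof.
move=> xc c2; have [h1 h2] := expR_taylor1 (le_trans xc c2).
by move: xc; rewrite !ler_norml => /andP[? ?]; apply/andP; split; nra.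
Qed.

End Negligible.

(** * Expectations of bounded functions *)

Section BoundedMeasurable.
Context {R : realType} {d : measure_display} {T : measurableType d}.
Implicit Types (Y Z : T -> R).

Definition bounded_mfun Y : Prop :=
  measurable_fun setT Y /\ exists K : R, forall w, `|Y w| <= K.

Lemma bounded_mfun_cst c : bounded_mfun (fun=> c).
Proof. by split; [exact: measurable_cst|exists `|c|]. Qed.

Lemma bounded_mfun_indic (A : set T) : measurable A -> bounded_mfun (\1_A).
Proof.
move=> mA; split; first exact: measurable_indic.
exists 1 => w; rewrite indicE; case: (_ \in _); rewrite ?normr1 ?normr0//.
Qed.

Lemma bounded_mfunD Y Z : bounded_mfun Y -> bounded_mfun Z ->
  bounded_mfun (fun w => Y w + Z w).
Proof.
move=> [mY [K hK]] [mZ [L hL]]; split; first exact: measurable_funD.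
by exists (K + L) => w; rewrite (le_trans (ler_normD _ _))// lerD.
Qed.

Lemma bounded_mfunM Y Z : bounded_mfun Y -> bounded_mfun Z ->
  bounded_mfun (fun w => Y w * Z w).
Proof.
move=> [mY [K hK]] [mZ [L hL]]; split; first exact: measurable_funM.
by exists (K * L) => w; rewrite normrM ler_pM.
Qed.

Lemma bounded_mfunZ c Y : bounded_mfun Y -> bounded_mfun (fun w => c * Y w).
Proof. exact/bounded_mfunM/bounded_mfun_cst. Qed.

Lemma bounded_mfunB Y Z : bounded_mfun Y -> bounded_mfun Z ->
  bounded_mfun (fun w => Y w - Z w).
Proof.
move=> bY /(bounded_mfunZ (-1)) bZ.
rewrite (_ : (fun _ => _) = (fun w => Y w + -1 * Z w)); first exact: bounded_mfunD.
by apply/funext => w; rewrite mulN1r.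
Qed.

Lemma bounded_mfun_norm Y : bounded_mfun Y -> bounded_mfun (fun w => `|Y w|).
Proof.
move=> [mY [K hK]]; split; last by exists K => w; rewrite normr_id.
exact: measurableT_comp.
Qed.

Lemma bounded_mfun_sum (I : Type) (s : seq I) (Y : I -> T -> R) :
  (forall i, bounded_mfun (Y i)) -> bounded_mfun (fun w => \sum_(i <- s) Y i w).
Proof.
move=> bY; elim: s => [|i s IH].
  rewrite (_ : (fun _ => _) = (fun=> 0)); first exact: bounded_mfun_cst.
  by apply/funext => w; rewrite big_nil.
rewrite (_ : (fun _ => _) = (fun w => Y i w + \sum_(j <- s) Y j w)).
  exact: bounded_mfunD.
by apply/funext => w; rewrite big_cons.
Qed.

Context (P : probability T R).

Definition Ex Y : R := \int[P]_w Y w.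

Lemma bounded_mfun_integrable Y (A : set T) : measurable A ->
  bounded_mfun Y -> P.-integrable A (EFin \o Y).
Proof.
move=> mA [mY [K hK]]; apply: measurable_bounded_integrable => //.
- by apply: le_lt_trans (probability_le1 P mA) _; rewrite ltry.
- exact: measurable_funTS.
- exists K; split; first exact: num_real.
  by move=> L KL w _ /=; apply: le_trans (hK w) (ltW KL).
Qed.

Lemma ExE Y : bounded_mfun Y -> (Ex Y)%:E = (\int[P]_w (Y w)%:E)%E.
Proof.
by move=> bY; rewrite /Ex /Rintegral fineK//; apply: integrable_fin_num => //;
  exact: bounded_mfun_integrable.
Qed.

Lemma Ex_cst c : Ex (fun=> c) = c.
Proof. by rewrite /Ex Rintegral_cst// [X in fine X]probability_setT /= mulr1. Qed.

Lemma ExD Y Z : bounded_mfun Y -> bounded_mfun Z ->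
  Ex (fun w => Y w + Z w) = Ex Y + Ex Z.
Proof. by move=> bY bZ; apply: RintegralD => //; exact: bounded_mfun_integrable. Qed.

Lemma ExB Y Z : bounded_mfun Y -> bounded_mfun Z ->
  Ex (fun w => Y w - Z w) = Ex Y - Ex Z.
Proof. by move=> bY bZ; apply: RintegralB => //; exact: bounded_mfun_integrable. Qed.

Lemma ExZ c Y : bounded_mfun Y -> Ex (fun w => c * Y w) = c * Ex Y.
Proof. by move=> bY; apply: RintegralZl => //; exact: bounded_mfun_integrable. Qed.

Lemma Ex_le Y Z : bounded_mfun Y -> bounded_mfun Z ->
  (forall w, Y w <= Z w) -> Ex Y <= Ex Z.
Proof.
by move=> bY bZ h; apply: le_Rintegral => //; exact: bounded_mfun_integrable.
Qed.

Lemma Ex_ge0 Y : (forall w, 0 <= Y w) -> 0 <= Ex Y.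
Proof. by move=> h; apply: Rintegral_ge0. Qed.

Lemma Ex_norm_le Y Z : bounded_mfun Y -> bounded_mfun Z ->
  (forall w, `|Y w| <= Z w) -> `|Ex Y| <= Ex Z.
Proof.
move=> bY bZ h; apply: le_trans (le_normr_Rintegral _ _) _ => //.
  exact: bounded_mfun_integrable.
by apply: Ex_le => //; exact: bounded_mfun_norm.
Qed.

Lemma Ex_sum (I : Type) (s : seq I) (Y : I -> T -> R) :
  (forall i, bounded_mfun (Y i)) ->
  Ex (fun w => \sum_(i <- s) Y i w) = \sum_(i <- s) Ex (Y i).
Proof.
move=> bY; elim: s => [|i s IH].
  rewrite big_nil -[RHS](Ex_cst 0); congr Ex.
  by apply/funext => w; rewrite big_nil.
rewrite big_cons -IH -ExD//; last exact: bounded_mfun_sum.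
by congr Ex; apply/funext => w; rewrite big_cons.
Qed.

Lemma Ex_indic (A : set T) : measurable A -> (Ex (\1_A))%:E = P A.
Proof.
by move=> mA; rewrite ExE ?integral_indic ?setIT//; exact: bounded_mfun_indic.
Qed.

Lemma indicI_mul (A B : set T) w : \1_(A `&` B) w = \1_A w * \1_B w :> R.
Proof. by rewrite !indicE in_setI; case: (_ \in A); case: (_ \in B);
  rewrite ?mulr0 ?mulr1 ?mul0r. Qed.

Lemma sum_ltn_nat (f M : nat) : \sum_(0 <= k < M) (k < f)%:R = (minn f M)%:R :> R.
Proof.
elim: M => [|M IH]; first by rewrite big_nil minn0.
rewrite big_nat_recr//= IH -natrD; congr (_%:R).
by case: ltnP => ?; lia.
Qed.

(* Layer-cake approximation of [Y] by a combination of its superlevel sets. *)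
Lemma Ex_superlevel (S : set (set T)) Y Z e : 0 <= e ->
  bounded_mfun Y -> bounded_mfun Z -> (forall w, 0 <= Y w) ->
  (forall x, 0 < x -> S [set w | x <= Y w]) ->
  (forall B, S B -> measurable B /\
     `|Ex (fun w => \1_B w * Z w)| <= e * Ex (\1_B)) ->
  `|Ex (fun w => Y w * Z w)| <= e * Ex Y.
Proof.
move=> e0 bY bZ Y0 YS hS; have [mY [K0 hK0]] := bY; have [mZ [C hC]] := bZ.
(* The maximum with 1 keeps the bound positive, so that it can be divided by. *)
pose K := Num.max K0 1; have K_gt0 : 0 < K by rewrite lt_max ltr01 orbT.
have hK w : Y w <= K.
  by rewrite le_max (le_trans (ler_norm _) (hK0 w)).
apply: (@le_of_inv _ _ _ (K * C)) => m.
have m0 : 0 < m.+1%:R :> R by rewrite ltr0n.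
pose x (k : nat) := k.+1%:R * (K / m.+1%:R).
have x0 k : 0 < x k by rewrite mulr_gt0 ?ltr0n ?divr_gt0.
pose B k : set T := [set w | x k <= Y w].
have bB k : bounded_mfun (\1_(B k)).
  by apply: bounded_mfun_indic; exact: (hS _ (YS _ (x0 k))).1.
(* [Ym] is [Y] rounded down to a multiple of K / (m + 1). *)
pose Ym w := \sum_(0 <= k < m.+1) K / m.+1%:R * \1_(B k) w.
have YmE w : Ym w <= Y w /\ Y w <= Ym w + K / m.+1%:R.
  pose y := Y w * m.+1%:R / K.
  have y0 : 0 <= y by rewrite divr_ge0 ?mulr_ge0// ltW.
  have yE : Y w = y * (K / m.+1%:R).
    by rewrite /y mulrA divfK ?gt_eqF// mulfK ?gt_eqF.
  have ym : y <= m.+1%:R by rewrite ler_pdivrMr// mulrC ler_wpM2l// ltW.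
  have tm : (Num.truncn y <= m.+1)%N.
    by rewrite -(ler_nat R) (le_trans _ ym)// truncn_le.
  have -> : Ym w = (Num.truncn y)%:R * (K / m.+1%:R).
    rewrite /Ym -mulr_sumr mulrC; congr (_ * _).
    rewrite -[X in X%:R](minn_idPl tm) -sum_ltn_nat; apply: eq_bigr => k _.
    rewrite indicE; congr ((_ : bool)%:R); apply/idP/idP.
      rewrite in_setE /B /= /x yE ler_pM2r ?divr_gt0// => ky.
      by rewrite truncn_ge_nat.
    rewrite in_setE /B /= /x yE ler_pM2r ?divr_gt0// => ky.
    by rewrite -truncn_ge_nat.
  have c0 : 0 <= K / m.+1%:R by rewrite ltW// divr_gt0.
  rewrite yE; split; first by rewrite ler_wpM2r// truncn_le.
  rewrite -[X in _ <= _ + X]mul1r -mulrDl ler_wpM2r// natr1 ltW//.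
  exact: truncnS_gt.
have bYm : bounded_mfun Ym.
  by apply: bounded_mfun_sum => k; exact: bounded_mfunZ.
have le1 : `|Ex (fun w => Ym w * Z w)| <= e * Ex Ym.
  have -> : Ex (fun w => Ym w * Z w) =
      \sum_(0 <= k < m.+1) K / m.+1%:R * Ex (fun w => \1_(B k) w * Z w).
    transitivity (Ex (fun w => \sum_(0 <= k < m.+1)
        (K / m.+1%:R * (\1_(B k) w * Z w)))).
      congr Ex; apply/funext => w; rewrite mulr_suml.
      by apply: eq_bigr => k _; rewrite mulrA.
    rewrite Ex_sum; last by move=> k; exact/bounded_mfunZ/bounded_mfunM.
    by apply: eq_bigr => k _; rewrite ExZ//; exact: bounded_mfunM.
  apply: le_trans (ler_norm_sum _ _ _) _.
  rewrite Ex_sum; last by move=> k; exact: bounded_mfunZ.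
  rewrite mulr_sumr; apply: ler_sum => k _.
  rewrite ExZ// normrM gtr0_norm ?divr_gt0// mulrCA ler_pM2l ?divr_gt0//.
  exact: (hS _ (YS _ (x0 k))).2.
have le2 : `|Ex (fun w => (Y w - Ym w) * Z w)| <= K / m.+1%:R * C.
  rewrite -[leRHS]Ex_cst; apply: Ex_norm_le.
  - by apply: bounded_mfunM => //; exact: bounded_mfunB.
  - exact: bounded_mfun_cst.
  move=> w; rewrite normrM ler_pM//; have [] := YmE w; rewrite ler_norml.
  move=> h1 h2; apply/andP; split; last by rewrite lerBlDr addrC.
  by apply: (@le_trans _ _ 0); rewrite ?subr_ge0// oppr_le0 ltW// divr_gt0.
have -> : Ex (fun w => Y w * Z w) =
    Ex (fun w => Ym w * Z w) + Ex (fun w => (Y w - Ym w) * Z w).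
  rewrite -ExD; [|exact: bounded_mfunM|]; last first.
    by apply: bounded_mfunM => //; exact: bounded_mfunB.
  by congr Ex; apply/funext => w; rewrite -mulrDl addrC subrK.
apply: le_trans (ler_normD _ _) _; apply: lerD.
  apply: le_trans le1 _; rewrite ler_wpM2l//; apply: Ex_le => // w.
  by have [] := YmE w.
by rewrite mulrAC in le2 *; exact: le2.
Qed.

(** For [B] in the conditioning sigma-algebra the left side is the integral over [B] of [f - c], so
    the almost sure bound can be integrated. *)
Lemma cond_prob_indic (G : set (set T)) (A B : set T) f c e :
  measurable A -> measurable B -> G B -> is_cond_prob P G A f ->
  {ae P, forall w, B w -> `|f w - c| <= e} -> 0 <= e ->
  measurable_fun setT f ->
  `|Ex (fun w => \1_B w * (\1_A w - c))| <= e * Ex (\1_B).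
Proof.
move=> mA mB GB [_ fint /(_ B GB) fB] hae e0 mf.
have bA := bounded_mfun_indic mA; have bB := bounded_mfun_indic mB.
have fintB : P.-integrable B (EFin \o f).
  exact: integrableS fint.
have -> : Ex (fun w => \1_B w * (\1_A w - c)) = \int[P]_(w in B) (f w - c).
  rewrite RintegralB//; last exact: finite_measure_integrable_cst.
  rewrite [X in _ = X - _]/Rintegral fB Rintegral_cst//.
  transitivity (Ex (fun w => \1_(A `&` B) w - c * \1_B w)).
    congr Ex; apply/funext => w; rewrite indicI_mul.
    by ring.
  have mAB : measurable (A `&` B) by exact: measurableI.
  rewrite ExB ?ExZ//; [|exact: bounded_mfun_indic|exact: bounded_mfunZ].
  rewrite -(Ex_indic mAB) /=; congr (_ - c * _).
  exact: (congr1 fine (Ex_indic mB)).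
have int2 : P.-integrable B (EFin \o (fun w => f w - c)).
  rewrite (_ : _ \o _ = fun w => ((f w)%:E - c%:E)%E)//.
  by apply: integrableB => //; exact: finite_measure_integrable_cst.
apply: le_trans (le_normr_Rintegral mB int2) _.
have -> : e * Ex (\1_B) = \int[P]_(w in B) e.
  rewrite Rintegral_cst//; congr (e * _); exact: (congr1 fine (Ex_indic mB)).
rewrite /Rintegral fine_le//.
- have := @integrable_norm _ _ _ P _ _ int2.
  by apply: integrable_fin_num.
- by apply: integrable_fin_num => //; exact: (@finite_measure_integrable_cst _ _ _ P B e).
apply: ae_ge0_le_integral => //.
- apply/measurable_EFinP/measurableT_comp => //.
  by apply: measurable_funB => //; exact: measurable_funTS.
Qed.

End BoundedMeasurable.

(** * Jump rates and multiplicative weights *)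

Section Rates.
Context {R : realType} {V : choiceType} (adj : rel V).

(** An enumeration of the neighbours; it is faithful because bounded degree makes the set finite. *)
Definition nbr (i : V) : seq V := fset_set [set j | adj i j].

Lemma nbr_uniq i : uniq (nbr i). Proof. exact: fset_uniq. Qed.

Lemma mem_nbr (hdeg : bounded_degree adj) i j : (j \in nbr i) = adj i j.
Proof.
have [D hD] := hdeg; rewrite in_fset_set; last first.
  exact: card_le_finite (hD i) (finite_II D).
by apply/idP/idP; rewrite in_setE.
Qed.

(** The default of [head] is met only for the empty history, which has no explored edge, so the
    value is then [b]. *)
Definition rate (b : R) (z : seq V) (j : V) : R :=
  if `[< edges_along z [set head j z; j] >] then 1 else b.

Definition total_rate (b : R) (z : seq V) : R :=
  if z is i :: _ then \sum_(j <- nbr i) rate b z j else 0.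

Lemma rate_gt0 b z j : 0 < b -> 0 < rate b z j.
Proof. by rewrite /rate; case: ifP. Qed.

Lemma rate_ge0 b z j : 0 < b -> 0 <= rate b z j.
Proof. by move=> b0; exact/ltW/rate_gt0. Qed.

Lemma total_rate_ge0 b z : 0 < b -> 0 <= total_rate b z.
Proof.
by move=> b0; case: z => //= i l; apply: sumr_ge0 => j _; exact: rate_ge0.
Qed.

End Rates.

Section Weights.
Context {R : realType} {V : choiceType} (adj : rel V) (o : V).
Context {d : measure_display} {Omega : measurableType d} (X : Omega -> R -> V).
Hypothesis hX : nearest_neighbour_process X adj o.
Hypothesis cV : countable [set: V].
(* [theta z]: exponential rate of the weight while the history is [z];
   [alpha l x]: factor gained when the history [l] is extended by [x]. *)
Variables (theta : seq V -> R) (alpha : seq V -> V -> R).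

(** A one-vertex history has weight 1, since starting at the root is not a jump. *)
Fixpoint jump_weight (z : seq V) : R :=
  if z is x :: l then (if l is _ :: _ then jump_weight l * alpha l x else 1) else 1.

(** The integral of [theta] along the successive histories up to time [t]. A history has one jump
    fewer than its size, so [z = x :: l] is entered at jump [size l] and left at jump [size z];
    truncation at [t] keeps the summands finite and measurable in the past of [t]. *)
Fixpoint hold_weight (z : seq V) (t : R) (w : Omega) : R :=
  if z is x :: l then
    hold_weight l t w +
    theta z * (stopped_tau X (size z) t w - stopped_tau X (size l) t w)
  else 0.

Definition weight (z : seq V) (t : R) (w : Omega) : R :=
  jump_weight z * expR (hold_weight z t w).

Lemma hold_weight_le z : exists2 C : R, 0 <= C &
  forall t w, 0 <= t -> `|hold_weight z t w| <= C * t.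
Proof.
elim: z => [|x l [C C0 IH]]; first by exists 0 => // t w _; rewrite normr0 mul0r.
exists (C + `|theta (x :: l)|); first by rewrite addr_ge0.
move=> t w t0 /=; rewrite mulrDl (le_trans (ler_normD _ _))// lerD ?IH//.
rewrite normrM ler_wpM2l//.
have := stopped_tau_ge0 X (size l) w t0; have := stopped_tau_le X (size l).+1 w t0.
have := stopped_tau_leS X (size l) w t0; rewrite ler_norml => *.
by apply/andP; split; lra.
Qed.

Lemma weight_le z T : exists2 K : R, 0 <= K &
  forall t w, 0 <= t -> t <= T -> `|weight z t w| <= K.
Proof.
have [C C0 hC] := hold_weight_le z.
exists (`|jump_weight z| * expR (C * T)); first by rewrite mulr_ge0// expR_ge0.
move=> t w t0 tT; rewrite normrM ler_wpM2l// gtr0_norm ?expR_gt0// ler_expR.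
apply: le_trans (ler_norm _) _; apply: le_trans (hC _ _ t0) _.
exact: ler_wpM2l.
Qed.

Lemma measurable_weight z t : 0 <= t ->
  measurable_fun (setT : set (past X t)) (weight z t : past X t -> R).
Proof.
move=> t0; apply: measurable_funM => //.
apply: measurableT_comp => //.
elim: z => [|x l IH] /=; first exact: measurable_cst.
apply: measurable_funD => //; apply: measurable_funM => //.
by apply: measurable_funB; exact: (measurable_stopped_tau hX).
Qed.

Lemma past_measurable_fun t (Y : Omega -> R) :
  measurable_fun (setT : set (past X t)) (Y : past X t -> R) -> measurable_fun setT Y.
Proof.
move=> h _ B mB; rewrite setTI; apply: (past_measurable hX (t := t)).
by rewrite -[X in measurable X]setTI; exact: h.
Qed.

Lemma hold_weight_const l s t w : 0 <= s -> s <= t ->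
  (tau (X w) (size l) <= s%:E)%E -> hold_weight l t w = hold_weight l s w.
Proof.
move=> s0 st; have t0 := le_trans s0 st; have st' : (s%:E <= t%:E)%E by rewrite lee_fin.
elim: l => [//|x l IH] h; have h' := le_trans (tau_geS (X w) (size l)) h.
rewrite /= IH// !stopped_tau_before//; exact: le_trans st'.
Qed.

Lemma hold_weight_stay z t h w : 0 <= t -> 0 <= h ->
  history (X w) z t -> history (X w) z (t + h) ->
  hold_weight z (t + h) w = hold_weight z t w + theta z * h.
Proof.
case: z => [|x l] t0 h0; first by move=> /history_nil.
move=> hy hx; have [_ _ [k1 k2]] := history_cons hy; have [_ _ [k3 k4]] := history_cons hx.
have th : t <= t + h by rewrite lerDl.
have t0' := le_trans t0 th.
rewrite /= (hold_weight_const t0 th k1).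
rewrite (stopped_tau_after t0 (ltW k2)) (stopped_tau_after t0' (ltW k4)).
by rewrite (stopped_tau_before t0 k1) (stopped_tau_before t0' k3); ring.
Qed.

(** With the jump at time u, the exponent grows by [theta l] times u - t plus [theta (x :: l)] times
    t + h - u, and both durations are at most [h]. *)
Lemma hold_weight_jump x l t h w : 0 <= t -> 0 <= h ->
  history (X w) l t -> history (X w) (x :: l) (t + h) ->
  `|hold_weight (x :: l) (t + h) w - hold_weight l t w|
    <= (`|theta l| + `|theta (x :: l)|) * h.
Proof.
case: l => [|y l] t0 h0; first by move=> /history_nil.
move=> hy hx; have [_ _ [k1 k2]] := history_cons hy; have [_ _ [k3 k4]] := history_cons hx.
have th : t <= t + h by rewrite lerDl.
have t0' := le_trans t0 th.
have k1' : (tau (X w) (size l) <= (t + h)%:E)%E.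
  by apply: le_trans k1 _; rewrite lee_fin.
rewrite [hold_weight _ (t + h) w]/= (hold_weight_const t0 th k1).
rewrite [hold_weight (y :: l) t w]/=.
rewrite (stopped_tau_after t0 (ltW k2)) (stopped_tau_after t0' (ltW k4)).
rewrite (stopped_tau_before t0 k1) (stopped_tau_before t0' k1').
rewrite (stopped_tau_before t0' k3).
have k2r := k2; have k3r := k3.
rewrite (jtimeE k3) lte_fin in k2r; rewrite (jtimeE k3) lee_fin in k3r.
set a := theta _; set b := theta _; set u := jtime _ (size (y :: l)).
have {}k2r : t < u := k2r; have {}k3r : u <= t + h := k3r.
rewrite (_ : _ - _ = a * (u - t) + b * (t + h - u)); last by ring.
rewrite mulrDl (le_trans (ler_normD _ _))// !normrM.
by apply: lerD; apply: ler_wpM2l => //; rewrite ler_norml; apply/andP; split; lra.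
Qed.

End Weights.

(** * One step of the walk *)

Section Step.
Context {R : realType} {V : choiceType} (adj : rel V) (o : V).
Context {d : measure_display} {Omega : measurableType d} (X : Omega -> R -> V).
Hypothesis hX : nearest_neighbour_process X adj o.
Hypothesis cV : countable [set: V].
Hypothesis hG : simple_graph adj.
Hypothesis hdeg : bounded_degree adj.

Definition history_set (z : seq V) (t : R) : set Omega := [set w | history (X w) z t].

Definition at_vertex (j : V) (t : R) : set Omega := [set w | X w t = j].

Definition two_jumps (t u : R) : set Omega := [set w | exists s1 s2 : R,
  [/\ t < s1, s1 < s2, s2 < u, jump_time (X w) s1 & jump_time (X w) s2]].

Lemma measurable_history_set z t : 0 <= t -> measurable (history_set z t).
Proof. by move=> t0; apply: (past_measurable hX (t := t)); exact: past_history hX _ _ _. Qed.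

Lemma measurable_at_vertex j t : 0 <= t -> measurable (at_vertex j t).
Proof. by move=> t0; exact: (hX.1 _ [set j]). Qed.

(** Extends the defining transition estimate from events to nonnegative past-measurable factors by
    layers. The factor is supported on one history so that the rate is a constant there. *)
Lemma jump_Ex b (P : probability Omega R) i j : 0 < b -> orrw X adj b P -> adj i j ->
  exists eps : R -> R, [/\ le_small eps, forall h, 0 <= eps h &
    forall t h l (Y : Omega -> R), 0 <= t -> 0 < h -> (forall w, 0 <= Y w) ->
      measurable_fun (setT : set (past X t)) (Y : past X t -> R) ->
      bounded_mfun Y -> (forall w, Y w != 0 -> history_set (i :: l) t w) ->
      `|Ex P (fun w => Y w * (\1_(at_vertex j (t + h)) w - rate b (i :: l) j * h))|
        <= eps h * Ex P Y].
Proof.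
move=> b0 [/(_ i j) H _] ij; have [eps heps {}H] := H ij.
exists (fun h => `|eps h|); split => // [|t h l Y t0 h0 Y0 mY bY Yz].
  exact: little_o_small.
have [f hf ae_f] := H t h t0 h0.
have th0 : 0 <= t + h by rewrite addr_ge0// ltW.
apply: (@Ex_superlevel _ _ _ P [set B | (@measurable _ (past X t)) B /\
   B `<=` history_set (i :: l) t] Y
   (fun w => \1_(at_vertex j (t + h)) w - rate b (i :: l) j * h)) => //.
- apply: bounded_mfunB; last exact: bounded_mfun_cst.
  by apply: bounded_mfun_indic; exact: measurable_at_vertex.
- move=> x x0; split => [|w xY]; last first.
    by apply: Yz; rewrite gt_eqF// (lt_le_trans x0).
  rewrite (_ : [set _ | _] = setT `&` (Y : past X t -> R) @^-1` `[x, +oo[).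
    exact: mY.
  by rewrite setTI; apply/seteqP; split => w; rewrite /= in_itv /= andbT.
move=> B [mB Bz]; split; first exact: (past_measurable hX mB).
apply: (@cond_prob_indic _ _ _ _ (sigma_upto X t%:E) _ _ f) => //.
- exact: measurable_at_vertex.
- exact: (past_measurable hX mB).
- apply: filterS ae_f => w hw Bw; have hz := Bz _ Bw.
  have [Xi _ _] := history_cons hz; have := hw Xi.
  (* On a fixed history the random set of traversed edges is [edges_along]. *)
  rewrite (history_traversed (hX.2 w) hz) /rate /=.
  case: ifP => _ hle; rewrite ?mul1r; exact: le_trans hle (ler_norm _).
- case: hf => mf _ _ _ C mC; rewrite setTI.
  exact: (past_measurable hX (t := t) (mf C mC)).
Qed.

Lemma two_jumps_Ex b (P : probability Omega R) : orrw X adj b P ->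
  exists eps : R -> R, [/\ le_small eps, forall h, 0 <= eps h &
    forall t h, 0 <= t -> 0 < h -> Ex P (\1_(two_jumps t (t + h))) <= eps h].
Proof.
move=> [_ [eps heps H]]; exists (fun h => `|eps h|); split => // [|t h t0 h0].
  exact: little_o_small.
rewrite -lee_fin (Ex_indic P (measurable_two_jumps hX cV t (t + h))).
by apply: le_trans (H t h t0 h0) _; rewrite lee_fin ler_norm.
Qed.

(** The window has length 2h because [two_jumps] is an open condition at its right end, while the
    history at t + h includes a jump exactly at t + h. *)
Lemma history_step w z z' t h : 0 <= t -> 0 < h ->
  ~ two_jumps t (t + 2 * h) w ->
  history (X w) z t -> history (X w) z' (t + h) ->
  z' = z \/ exists2 x, z' = x :: z & adj (head x z) x.
Proof.
move=> t0 h0 nJ [n zE jn] [m z'E jm].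
have nm : (n <= m)%N by apply: jumps_at_le jn jm _; rewrite lerDl ltW.
have mn : (m <= n.+1)%N.
  rewrite leqNgt; apply/negP => nm'; apply: nJ; apply/(two_jumpsP (hX.2 w)).
  exists n; split; first exact: jn.2.
  apply: le_lt_trans (tau_le (X w) nm') _; apply: le_lt_trans jm.1 _.
  by rewrite lte_fin; lra.
move: mn; rewrite leq_eqVlt => /predU1P[me|]; last first.
  by rewrite ltnS => mn; left; rewrite zE z'E; congr trace; apply/eqP; rewrite eqn_leq mn.
right; exists (X w (jtime (X w) m)); first by rewrite z'E zE me.
have -> : head (X w (jtime (X w) m)) z = X w (jtime (X w) n).
  by rewrite zE; case: (n).
by move: jm; rewrite me => -[jm _]; exact: (jump_adj (hX.2 w) jm).
Qed.

Section Pointwise.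
Variables (theta : seq V -> R) (alpha : seq V -> V -> R).
Local Notation W := (weight X theta alpha).

(** First-order expansion of the weighted indicator, path by path. Without two close jumps, being at
    a neighbour of [x] at t + h means that [z] has been left, and being at [x] after [l] means that
    [z] has been entered; there are no loops. In the constant, 3 + alpha is the crude bound under
    two jumps, 2 M^2 the Taylor remainder while staying, and 2 alpha M the change of the exponent
    while entering. *)
Lemma step_pointwise (x : V) (l : seq V) (K : R) (t h : R) (w : Omega) :
  let z := x :: l in
  let M := `|theta l| + `|theta z| in
  (if l is y :: _ then adj y x else true) -> 0 <= alpha l x ->
  0 <= t -> 0 < h -> M * h <= 2^-1 -> h <= 1 ->
  `|W z t w| <= K -> `|W l t w| <= K -> `|W z (t + h) w| <= K ->
  `| \1_(history_set z (t + h)) w * W z (t + h) w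
     - (\1_(history_set z t) w * W z t w) * (1 + theta z * h)
       * (1 - \1_[set w | adj x (X w (t + h))] w)
     - alpha l x * ((\1_(history_set l t) w * W l t w) * \1_(at_vertex x (t + h)) w) |
  <= (K * (3 + alpha l x + 2 * M ^+ 2 + 2 * alpha l x * M)) *
     (\1_(two_jumps t (t + 2 * h)) w + h ^+ 2
      + h * (\1_(history_set l t) w * \1_(at_vertex x (t + h)) w)).
Proof.
move=> z M hadj a0 t0 h0 Mh h1 K1 K2 K3.
have K0 : 0 <= K by apply: le_trans K1.
have M0 : 0 <= M by rewrite addr_ge0.
have thM : `|theta z| <= M by rewrite lerDr.
have ind01 (A : set Omega) : 0 <= (\1_A w : R) <= 1.
  by rewrite indicE; case: (_ \in _); rewrite ?ler01 ?lexx.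
have th0 : 0 <= t + h by rewrite addr_ge0// ltW.
set A := alpha l x in a0 *.
set C := K * _.
have C0 : 0 <= C.
  by rewrite mulr_ge0// !addr_ge0 ?mulr_ge0 ?sqr_ge0.
have AC : K * (3 + A) <= C.
  by rewrite /C ler_wpM2l// -[leRHS]addrA lerDl addr_ge0 ?mulr_ge0 ?sqr_ge0.
have rest0 : 0 <= h ^+ 2 + h * (\1_(history_set l t) w * \1_(at_vertex x (t + h)) w).
  apply: addr_ge0; first exact: sqr_ge0.
  apply: mulr_ge0; first exact: ltW.
  by apply: mulr_ge0; [have /andP[] := ind01 (history_set l t)|
                       have /andP[] := ind01 (at_vertex x (t + h))].
(* On this event nothing cancels: the three terms are bounded by K, 2K and alpha K. *)
have [J|nJ] := pselect (two_jumps t (t + 2 * h) w).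
  apply: (@le_trans _ _ (K * (3 + A))); last first.
    apply: le_trans AC _; rewrite -[leLHS]mulr1 ler_wpM2l//.
    rewrite (_ : \1_(two_jumps _ _) w = 1); last by rewrite indicE mem_set.
    by rewrite -addrA lerDl.
  have b1 (A1 : set Omega) y : `|y| <= K -> `| \1_A1 w * y| <= K.
    move=> yK; rewrite normrM; have /andP[p0 p1] := ind01 A1.
    by rewrite (ger0_norm p0) (le_trans _ yK)// ler_piMl.
  have c1 : `|1 + theta z * h| <= 2.
    rewrite (le_trans (ler_normD _ _))// normr1.
    have : `|theta z * h| <= 2^-1.
      by rewrite normrM (gtr0_norm h0) (le_trans _ Mh)// ler_wpM2r// ltW.
    lra.
  have c2 : `|1 - \1_[set w | adj x (X w (t + h))] w| <= 1 :> R.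
    have /andP[p0 p1] := ind01 [set w | adj x (X w (t + h))].
    by rewrite ler_norml; apply/andP; split; lra.
  have d1 := b1 (history_set z (t + h)) _ K3.
  have d2 : `| \1_(history_set z t) w * W z t w * (1 + theta z * h)
       * (1 - \1_[set w | adj x (X w (t + h))] w)| <= K * 2 * 1.
    by rewrite normrM ler_pM// normrM ler_pM// b1.
  have d3 : `|A * (\1_(history_set l t) w * W l t w * \1_(at_vertex x (t + h)) w)| <= A * K.
    rewrite normrM (ger0_norm a0) ler_wpM2l// normrM.
    rewrite -[K]mulr1 ler_pM// ?b1//.
    by have /andP[p0 p1] := ind01 (at_vertex x (t + h)); rewrite ger0_norm.
  apply: le_trans (ler_normB _ _) _; apply: le_trans (lerD (ler_normB _ _) (lexx _)) _.
  by lra.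
rewrite [\1_(two_jumps _ _) w]indicE memNset// add0r.
have [z0 hz0] := history_exists (hX.2 w) t0.
have [z1 hz1] := history_exists (hX.2 w) th0.
have step := history_step t0 h0 nJ hz0 hz1.
have inH z' : \1_(history_set z' t) w = (z' == z0)%:R :> R.
  rewrite indicE; congr (_%:R); congr nat_of_bool; apply/idP/eqP.
    by rewrite in_setE => /history_uniq; apply.
  by move=> ->; rewrite in_setE.
have inH1 z' : \1_(history_set z' (t + h)) w = (z' == z1)%:R :> R.
  rewrite indicE; congr (_%:R); congr nat_of_bool; apply/idP/eqP.
    by rewrite in_setE => /history_uniq; apply.
  by move=> ->; rewrite in_setE.
have Xth : z1 != [::] -> at_vertex (head x z1) (t + h) w.
  case: (z1) hz1 => // x1 l1 hz1' _; by have [] := history_cons hz1'.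
have z0n : z0 != [::].
  by apply/eqP => e; move: hz0; rewrite e => /history_nil.
have z1n : z1 != [::].
  by apply/eqP => e; move: hz1; rewrite e => /history_nil.
have {}Xth := Xth z1n.
rewrite !inH inH1 in rest0 *.
have lz : l != z by apply/eqP => /(congr1 size) /n_Sn.
have inX v : \1_(at_vertex v (t + h)) w = (v == head x z1)%:R :> R.
  rewrite indicE; congr (_%:R); congr nat_of_bool; apply/idP/eqP.
    by rewrite in_setE /at_vertex /= -Xth.
  by move=> ->; rewrite in_setE.
have inA : \1_[set w | adj x (X w (t + h))] w = (adj x (head x z1))%:R :> R.
  rewrite indicE; congr (_%:R); congr nat_of_bool.
  by rewrite -Xth; apply/idP/idP; rewrite in_setE.
rewrite inX inA in rest0 *.
have irr v : adj v v = false by have [_ ir] := hG; exact: ir.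
have {}rest0 : 0 <= C * h ^+ 2 by rewrite mulr_ge0 ?sqr_ge0.
(* Three possible histories at time [t] matter: [z], its tail [l], or neither, in which case all
   terms vanish. *)
have [ez|nz] := eqVneq z z0; last first.
  have [el|nl] := eqVneq l z0; last first.
    have -> : (z == z1) = false.
      apply/eqP => e1; case: step => [e2|[v e2 _]].
        by rewrite e2 in e1; rewrite e1 eqxx in nz.
      by move: e1; rewrite e2 => -[_ e3]; rewrite e3 eqxx in nl.
    by rewrite /= ?(mulr0n, mulr1n, mul0r, mulr0, mul1r, mulr1, subr0, addr0, subrr, normr0).
  case: step => [e2|[v e2 av]].
    have -> : (z == z1) = false by rewrite e2; apply/negbTE.
    have -> : (x == head x z1) = false.
      rewrite e2 -el; case: (l) hadj el => [|y l'] hadj' el'.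
        by rewrite -el' in z0n.
      by apply/eqP => /= e3; move: hadj'; rewrite e3 irr.
    by rewrite /= ?(mulr0n, mulr1n, mul0r, mulr0, mul1r, mulr1, subr0, addr0, subrr, normr0).
  have [ev|nv] := eqVneq x v; last first.
    have -> : (z == z1) = false.
      by apply/eqP => e1; move: e1; rewrite e2 => -[e3 _]; rewrite e3 eqxx in nv.
    have -> : (x == head x z1) = false by rewrite e2; apply/negbTE.
    by rewrite /= ?(mulr0n, mulr1n, mul0r, mulr0, mul1r, mulr1, subr0, addr0, subrr, normr0).
  have e1 : z1 = z by rewrite e2 /z -ev el.
  rewrite e1 eqxx /= eqxx; rewrite /= ?(mulr0n, mulr1n, mul0r, mulr0, mul1r, mulr1, subr0, addr0, subrr, normr0).
  rewrite e1 in hz1; rewrite -el in hz0.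
  have dj := hold_weight_jump theta t0 (ltW h0) hz0 hz1.
  (* Entering [z]: apart from the factor [A] the weight changes only through its exponent, an O(h)
     effect on an event whose probability is itself O(h). *)
  have -> : W z (t + h) w = A * W l t w *
      expR (hold_weight X theta z (t + h) w - hold_weight X theta l t w).
    have jz : jump_weight alpha z = jump_weight alpha l * A.
      rewrite /z /= /A; case: (l) el => [el'|//].
      by rewrite -el' in z0n.
    rewrite expRB /weight jz.
    by field; rewrite gt_eqF// expR_gt0.
  rewrite -{2}[A * _]mulr1 -mulrBr normrM.
  have h2 := expR_lip dj Mh.
  apply: (@le_trans _ _ (A * K * (2 * (M * h)))).
    rewrite ler_pM// normrM (ger0_norm a0) ler_wpM2l//.
  apply: (@le_trans _ _ (C * h)); last by rewrite ler_wpM2l// lerDr sqr_ge0.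
  rewrite (_ : A * K * _ = K * (2 * A * M) * h); last by ring.
  rewrite ler_wpM2r ?(ltW h0)// /C ler_wpM2l// lerDr.
  by rewrite !addr_ge0 ?mulr_ge0 ?sqr_ge0.
have lz0 : (l == z0) = false by rewrite -ez; apply/negbTE.
rewrite lz0.
case: step => [e1|[v e2 av]].
  have hx : head x z1 = x by rewrite e1 -ez.
  rewrite hx irr e1 ez eqxx; rewrite /= ?(mulr0n, mulr1n, mul0r, mulr0, mul1r, mulr1, subr0, addr0, subrr, normr0).
  rewrite -ez.
  rewrite e1 -ez in hz1; rewrite -ez in hz0.
  rewrite {1}/weight (hold_weight_stay theta t0 (ltW h0) hz0 hz1) expRD mulrA.
  rewrite -/(weight X theta alpha z t w) -mulrBr normrM.
  have thh : `|theta z * h| <= M * h.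
    by rewrite normrM (gtr0_norm h0) ler_wpM2r// ltW.
  have [g1 g2] := expR_taylor1 (le_trans thh Mh).
  rewrite opprD addrA [X in _ * X <= _]ger0_norm//.
  apply: (@le_trans _ _ (K * (2 * M ^+ 2 * h ^+ 2))).
    apply: ler_pM => //. apply: le_trans g2 _; rewrite -mulrA ler_wpM2l//.
    by rewrite -exprMn -[X in X <= _]real_normK ?num_real// ler_sqr ?nnegrE ?mulr_ge0// ltW.
  rewrite mulrA ler_wpM2r ?sqr_ge0// /C ler_wpM2l//.
  rewrite [leRHS](_ : _ = 2 * M ^+ 2 + (3 + A + 2 * A * M)); last by ring.
  by rewrite lerDl !addr_ge0 ?mulr_ge0.
(* Leaving [z]: the new indicator is 0, and the adjacency indicator cancels the old term. *)
have -> : (z == z1) = false.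
  by apply/eqP => /(congr1 size); rewrite e2 -ez => /n_Sn.
have -> : adj x (head x z1) by rewrite e2 /=; move: av; rewrite -ez.
by rewrite /= ?(mulr0n, mulr1n, mul0r, mulr0, mul1r, mulr1, subr0, addr0, subrr, normr0).
Qed.
End Pointwise.

End Step.

(** * Linear equations for weighted probabilities *)

Section StepExpectation.
Context {R : realType} {V : choiceType} (adj : rel V) (o : V).
Context {d : measure_display} {Omega : measurableType d} (X : Omega -> R -> V).
Hypothesis hX : nearest_neighbour_process X adj o.
Hypothesis cV : countable [set: V].
Hypothesis hG : simple_graph adj.
Hypothesis hdeg : bounded_degree adj.
Variables (theta : seq V -> R) (alpha : seq V -> V -> R).
Hypothesis alpha_ge0 : forall l x, 0 <= alpha l x.
Local Notation W := (weight X theta alpha).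

Definition extends (l : seq V) (x : V) : bool :=
  if l is y :: _ then adj y x else true.

(** One notion for both sides: with [theta] zero and [alpha] one it is the plain probability of [B]
    together with history [z] at time [t]. *)
Definition weighted_prob (P : probability Omega R) (B : set Omega) (z : seq V) (t : R) : R :=
  Ex P (fun w => \1_B w * (\1_(history_set X z t) w * W z t w)).

Lemma jump_weight_ge0 z : 0 <= jump_weight alpha z.
Proof.
elim: z => //= x l IH; case: l IH => [_|y l IH]; first exact: ler01.
exact: mulr_ge0.
Qed.

Lemma weight_ge0 z t w : 0 <= W z t w.
Proof. by rewrite /weight mulr_ge0 ?jump_weight_ge0// expR_ge0. Qed.

Lemma indic_ge0 (A : set Omega) w : 0 <= (\1_A w : R).
Proof. by rewrite indicE; case: (_ \in _). Qed.

Lemma indic_le1 (A : set Omega) w : (\1_A w : R) <= 1.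
Proof. by rewrite indicE; case: (_ \in _). Qed.

Lemma indic_mul_le (A : set Omega) (w : Omega) (y : R) : 0 <= y -> \1_A w * y <= y.
Proof. by move=> y0; rewrite ler_piMl// indic_le1. Qed.

Lemma Ex_bounds (P : probability Omega R) (Y : Omega -> R) K : bounded_mfun Y ->
  (forall w, `|Y w| <= K) -> `|Ex P Y| <= K.
Proof.
move=> bY h; rewrite -[leRHS](Ex_cst P).
by apply: Ex_norm_le => //; exact: bounded_mfun_cst.
Qed.

Lemma measurable_weighted t (B : set Omega) z : 0 <= t -> (@measurable _ (past X t)) B ->
  measurable_fun (setT : set (past X t))
    ((fun w => \1_B w * (\1_(history_set X z t) w * W z t w)) : past X t -> R).
Proof.
move=> t0 mB; apply: measurable_funM; first exact: (@measurable_indic _ (past X t)).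
apply: measurable_funM; last exact: (measurable_weight hX cV).
by apply: (@measurable_indic _ (past X t)); exact: (past_history hX).
Qed.

Lemma bounded_weighted t (B : set Omega) z : 0 <= t -> (@measurable _ (past X t)) B ->
  bounded_mfun (fun w : Omega => \1_B w * (\1_(history_set X z t) w * W z t w)).
Proof.
move=> t0 mB; split.
  have := measurable_weighted z t0 mB; exact: (past_measurable_fun hX).
have [K K0 hK] := weight_le X theta alpha z t.
exists K => w; rewrite normrM [X in _ * X <= _]normrM !(ger0_norm (indic_ge0 _ _)).
apply: le_trans (hK t w t0 (lexx t)).
apply: le_trans (indic_mul_le _ _ _) _; first by rewrite mulr_ge0 ?indic_ge0.
exact: indic_mul_le.
Qed.

(** Adds the case of an empty [l], where the support condition forces [Y] to vanish, so that
    one-vertex histories need no separate treatment. *)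
Lemma jump_Ex_extends b (P : probability Omega R) l x : 0 < b -> orrw X adj b P ->
  extends l x ->
  exists eps : R -> R, [/\ le_small eps, forall h, 0 <= eps h &
    forall t h (Y : Omega -> R), 0 <= t -> 0 < h -> (forall w, 0 <= Y w) ->
      measurable_fun (setT : set (past X t)) (Y : past X t -> R) ->
      bounded_mfun Y -> (forall w, Y w != 0 -> history_set X l t w) ->
      `|Ex P (fun w => Y w * (\1_(at_vertex X x (t + h)) w - rate b l x * h))|
        <= eps h * Ex P Y].
Proof.
move=> b0 hP; case: l => [_|y l /= yx].
  exists (fun=> 0); split => // [e e0|t h Y t0 h0 Y0 mY bY Yz].
    by exists 1 => // h h0 _; rewrite mulr_ge0// ltW.
  rewrite (_ : (fun _ => _) = (fun=> 0)) ?Ex_cst ?normr0 ?mul0r//.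
  apply/funext => w; have [->|/Yz/history_nil//] := eqVneq (Y w) 0.
  by rewrite mul0r.
have [eps [h1 h2 h3]] := jump_Ex hX b0 hP yx.
by exists eps; split => // t h Y; exact: h3.
Qed.

Lemma Ex_pointwise_le (P : probability Omega R) (Y' Y0 S1 Y1 X1 J E1 : Omega -> R)
    (c a C h : R) : 0 <= C ->
  bounded_mfun Y' -> bounded_mfun Y0 -> bounded_mfun S1 -> bounded_mfun Y1 ->
  bounded_mfun X1 -> bounded_mfun J -> bounded_mfun E1 ->
  (forall w, `|Y' w - c * (Y0 w - Y0 w * S1 w) - a * (Y1 w * X1 w)|
     <= C * (J w + h ^+ 2 + h * (E1 w * X1 w))) ->
  `|Ex P Y' - c * (Ex P Y0 - Ex P (fun w => Y0 w * S1 w))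
    - a * Ex P (fun w => Y1 w * X1 w)|
  <= C * (Ex P J + h ^+ 2 + h * Ex P (fun w => E1 w * X1 w)).
Proof.
move=> C0 bY' bY0 bS1 bY1 bX1 bJ bE1 le.
have bYS := bounded_mfunM bY0 bS1; have bYX := bounded_mfunM bY1 bX1.
have bEX := bounded_mfunM bE1 bX1; have bD := bounded_mfunB bY0 bYS.
have bZD := bounded_mfunZ c bD; have bZY := bounded_mfunZ a bYX.
have bYZ := bounded_mfunB bY' bZD; have bZE := bounded_mfunZ h bEX.
have bJh := bounded_mfunD bJ (bounded_mfun_cst (h ^+ 2)).
have bJE := bounded_mfunD bJh bZE.
rewrite -(ExB P bY0 bYS) -(ExZ P _ bD) -(ExB P bY' bZD) -(ExZ P _ bYX).
rewrite -(ExB P bYZ bZY) -[h ^+ 2](Ex_cst P) -(ExD P bJ (bounded_mfun_cst _)).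
rewrite -(ExZ P _ bEX) -(ExD P bJh bZE) -(ExZ P _ bJE).
by apply: Ex_norm_le => //; [exact: bounded_mfunB|exact: bounded_mfunZ].
Qed.

(** The forward equation of a Feynman-Kac weight: the diagonal coefficient is the growth rate of the
    weight minus the exit rate, and the only source is the tail [l], from which [z] is entered. The
    bound [K] makes the error uniform in time and in [B]. *)
Lemma step_Ex b (P : probability Omega R) x l K : 0 < b -> orrw X adj b P ->
  extends l x -> 0 <= K ->
  exists eps h0, [/\ le_small eps, 0 < h0 &
    forall t h (B : set Omega), 0 <= t -> 0 < h -> h < h0 -> (@measurable _ (past X t)) B ->
    (forall w, `|W (x :: l) t w| <= K) -> (forall w, `|W l t w| <= K) ->
    (forall w, `|W (x :: l) (t + h) w| <= K) ->
    `| weighted_prob P B (x :: l) (t + h)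
       - (1 + (theta (x :: l) - total_rate adj b (x :: l)) * h)
         * weighted_prob P B (x :: l) t
       - alpha l x * rate b l x * h * weighted_prob P B l t | <= eps h].
Proof.
move=> b0 hP lx K0; set z := x :: l.
pose M := `|theta l| + `|theta z|.
have M0 : 0 <= M by rewrite addr_ge0.
pose C := K * (3 + alpha l x + 2 * M ^+ 2 + 2 * alpha l x * M).
have C0 : 0 <= C by rewrite mulr_ge0// !addr_ge0 ?mulr_ge0 ?sqr_ge0.
have [el [el_small el0 hel]] := jump_Ex_extends b0 hP lx.
have /choice[ej hej] : forall j, exists eps : R -> R, [/\ le_small eps,
    forall h, 0 <= eps h & adj x j ->
    forall t h (Y : Omega -> R), 0 <= t -> 0 < h -> (forall w, 0 <= Y w) ->
      measurable_fun (setT : set (past X t)) (Y : past X t -> R) ->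
      bounded_mfun Y -> (forall w, Y w != 0 -> history_set X z t w) ->
      `|Ex P (fun w => Y w * (\1_(at_vertex X j (t + h)) w - rate b z j * h))|
        <= eps h * Ex P Y].
  move=> j; have [xj|xj] := boolP (adj x j).
    have [eps [h1 h2 h3]] := jump_Ex hX b0 hP xj.
    by exists eps; split => // _ t h Y; exact: h3.
  exists (fun=> 0); split => // e e0.
  by exists 1 => // h h0 _; rewrite mulr_ge0// ltW.
have [e2 [e2_small e20 he2]] := two_jumps_Ex hX cV hP.
pose r := rate b l x; have r0 : 0 <= r by exact: rate_ge0.
pose T := total_rate adj b z; have T0 : 0 <= T by exact: total_rate_ge0.
(* In order: the pointwise expansion, the exit probabilities, the cross term of (1 + theta h)(1 - T
   h), and the entry probability. *)
pose eps h := C * (e2 (2 * h) + (1 * h ^+ 2 + (h * el h + r * h ^+ 2)))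
  + (2 * (K * \sum_(j <- nbr adj x) ej j h) + ((`|theta z| * T * K) * h ^+ 2
  + alpha l x * K * el h)).
(* Ensures h <= 1 and M h <= 1/2, as the expansion of the exponential requires; M + 1 avoids
   division by zero. *)
exists eps, (Num.min 1 (2^-1 / (M + 1))); split.
- apply: smallD.
    apply: smallZ => //; apply: smallD; first exact: small_double.
    apply: smallD; first exact: small_sqr.
    by apply: smallD; [exact: small_mulh|exact: small_sqr].
  apply: smallD.
    apply: smallZ => //; apply: smallZ => //.
    by apply: small_sum => j; have [] := hej j.
  apply: smallD; first by apply: small_sqr; rewrite !mulr_ge0.
  by apply: smallZ => //; rewrite mulr_ge0.
- by rewrite lt_min ltr01 divr_gt0// ltr_wpDl.
move=> t h B t0 h0; rewrite lt_min => /andP[h1 hM] mB K1 K2 K3.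
have {}hM : M * h <= 2^-1.
  rewrite ltr_pdivlMr ?ltr_wpDl// in hM.
  by apply: ltW; apply: le_lt_trans hM; rewrite mulrC ler_pM2l// lerDl.
have th0 : 0 <= t + h by rewrite addr_ge0// ltW.
have mBO : measurable B := past_measurable hX mB.
have mB' : (@measurable _ (past X (t + h))) B.
  by apply: past_le mB; rewrite lerDl ltW.
have bI A : measurable A -> bounded_mfun (\1_A : Omega -> R).
  exact: bounded_mfun_indic.
pose Y0 w := \1_B w * (\1_(history_set X z t) w * W z t w).
pose Y1 w := \1_B w * (\1_(history_set X l t) w * W l t w).
pose Y' w := \1_B w * (\1_(history_set X z (t + h)) w * W z (t + h) w).
have bY0 : bounded_mfun Y0 by exact: bounded_weighted.
have bY1 : bounded_mfun Y1 by exact: bounded_weighted.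
have bY' : bounded_mfun Y' by exact: bounded_weighted.
have ge0Y z' w : 0 <= \1_B w * (\1_(history_set X z' t) w * W z' t w).
  by apply: mulr_ge0; [|apply: mulr_ge0]; rewrite ?indic_ge0 ?weight_ge0.
have leK z' w : `|W z' t w| <= K -> `|\1_B w * (\1_(history_set X z' t) w * W z' t w)| <= K.
  move=> WK; rewrite ger0_norm// (le_trans _ WK)// ger0_norm ?weight_ge0//.
  apply: le_trans (indic_mul_le _ _ _) _; first by rewrite mulr_ge0 ?indic_ge0 ?weight_ge0.
  exact/indic_mul_le/weight_ge0.
have a0K : `|Ex P Y0| <= K by apply: Ex_bounds => // w; exact: leK.
have a1K : `|Ex P Y1| <= K by apply: Ex_bounds => // w; exact: leK.
have a00 : 0 <= Ex P Y0 by apply: Ex_ge0 => w; exact: ge0Y.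
have a10 : 0 <= Ex P Y1 by apply: Ex_ge0 => w; exact: ge0Y.
have mX j : measurable (at_vertex X j (t + h)) by exact: (measurable_at_vertex hX).
have mA : measurable [set w | adj x (X w (t + h))] by exact: (hX.1 _ [set j | adj x j]).
pose S1 w : R := \1_[set w | adj x (X w (t + h))] w.
pose X1 w : R := \1_(at_vertex X x (t + h)) w.
have bS1 : bounded_mfun S1 by exact: bI.
have bX1 : bounded_mfun X1 by exact: bI.
have supp z' w : \1_B w * (\1_(history_set X z' t) w * W z' t w) != 0 ->
    history_set X z' t w.
  apply: contra_neqP => nh; rewrite [\1_(history_set _ _ _) w]indicE memNset//.
  by rewrite mul0r mulr0.
(* The indicator of being at a neighbour of [x] is the sum of the indicators over the finite list of
   neighbours, so the exit rate is the sum of the jump rates. *)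
have hS : `|Ex P (fun w => Y0 w * S1 w) - T * h * Ex P Y0|
    <= K * \sum_(j <- nbr adj x) ej j h.
  have -> : Ex P (fun w => Y0 w * S1 w) - T * h * Ex P Y0 =
     \sum_(j <- nbr adj x)
        Ex P (fun w => Y0 w * (\1_(at_vertex X j (t + h)) w - rate b z j * h)).
    rewrite -Ex_sum; last first.
      move=> j; apply: bounded_mfunM => //; apply: bounded_mfunB; first exact: bI.
      exact: bounded_mfun_cst.
    rewrite -ExZ// -ExB//; [|exact: bounded_mfunM|exact: bounded_mfunZ].
    congr Ex; apply/funext => w; rewrite -mulr_sumr sumrB -mulr_suml mulrBr.
    congr (_ - _); last by rewrite mulrC.
    congr (_ * _).
    have inX v : \1_(at_vertex X v (t + h)) w = (v == X w (t + h))%:R :> R.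
      rewrite indicE; congr (_%:R); congr nat_of_bool; apply/idP/eqP.
        by rewrite in_setE => <-.
      by move=> ->; rewrite in_setE.
    under eq_bigr do rewrite inX.
    rewrite -natr_sum -big_mkcond /= sum1_count count_uniq_mem ?nbr_uniq//.
    rewrite mem_nbr// /S1 indicE; congr (_%:R); congr nat_of_bool.
    by apply/idP/idP; rewrite in_setE.
  apply: le_trans (ler_norm_sum _ _ _) _.
  rewrite mulr_sumr; rewrite big_seq [leRHS]big_seq; apply: ler_sum => j.
  rewrite mem_nbr// => xj; have [_ ej0 {}hej] := hej j.
  have := hej xj t h Y0 t0 h0 (ge0Y z) (measurable_weighted z t0 mB) bY0 (supp z).
  move=> /le_trans; apply.
  by rewrite mulrC ler_wpM2r// (le_trans _ a0K)// ler_norm.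
have hQ : `|Ex P (fun w => Y1 w * X1 w) - r * h * Ex P Y1| <= K * el h.
  have -> : Ex P (fun w => Y1 w * X1 w) - r * h * Ex P Y1 =
      Ex P (fun w => Y1 w * (\1_(at_vertex X x (t + h)) w - r * h)).
    rewrite -ExZ// -ExB//; [|exact: bounded_mfunM|exact: bounded_mfunZ].
    by congr Ex; apply/funext => w; rewrite mulrBr [Y1 w * (_ * _)]mulrC.
  have := hel t h Y1 t0 h0 (ge0Y l) (measurable_weighted l t0 mB) bY1 (supp l).
  move=> /le_trans; apply.
  by rewrite mulrC ler_wpM2r// (le_trans _ a1K)// ler_norm.
have mHl : (@measurable _ (past X t)) (history_set X l t).
  exact: (past_history hX).
have mHlO : measurable (history_set X l t) := past_measurable hX mHl.
pose E1 w : R := \1_(history_set X l t) w.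
have bE1 : bounded_mfun E1 by exact: bI.
(* Entering from [l] has probability O(h), so the O(h) error made on that event contributes o(h). *)
have hq : Ex P (fun w => E1 w * X1 w) <= el h + r * h.
  have E1P : 0 <= Ex P E1 <= 1.
    rewrite (_ : 0 <= _) /=; last by apply: Ex_ge0 => w; exact: indic_ge0.
    rewrite -[leRHS](Ex_cst P); apply: Ex_le => //; first exact: bounded_mfun_cst.
    by move=> w; exact: indic_le1.
  have : `|Ex P (fun w => E1 w * (\1_(at_vertex X x (t + h)) w - r * h))| <= el h * Ex P E1.
    apply: (hel t h E1 t0 h0 _ _ bE1).
    - by move=> w; exact: indic_ge0.
    - exact: (@measurable_indic _ (past X t)).
    - by move=> w; apply: contra_neqP => nh; rewrite /E1 indicE memNset.
  have -> : Ex P (fun w => E1 w * (\1_(at_vertex X x (t + h)) w - r * h)) =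
      Ex P (fun w => E1 w * X1 w) - r * h * Ex P E1.
    rewrite -ExZ// -ExB//; [|exact: bounded_mfunM|exact: bounded_mfunZ].
    by congr Ex; apply/funext => w; rewrite mulrBr [E1 w * (_ * _)]mulrC.
  have rh0 : 0 <= r * h by rewrite mulr_ge0// ltW.
  have := el0 h; case/andP: E1P => p0 p1 q0; rewrite ler_norml => /andP[_ q1].
  rewrite lerBlDr in q1; apply: le_trans q1 _.
  by apply: lerD; rewrite ler_piMr.
have mJ : measurable (two_jumps X t (t + 2 * h)) by exact: (measurable_two_jumps hX cV).
have hJ : Ex P (\1_(two_jumps X t (t + 2 * h))) <= e2 (2 * h).
  by apply: he2 => //; rewrite mulr_gt0.
have main : `|Ex P Y' - (1 + theta z * h) * (Ex P Y0 - Ex P (fun w => Y0 w * S1 w))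
    - alpha l x * Ex P (fun w => Y1 w * X1 w)| <=
    C * (e2 (2 * h) + (1 * h ^+ 2 + (h * el h + r * h ^+ 2))).
  have bJ : bounded_mfun (\1_(two_jumps X t (t + 2 * h)) : Omega -> R) by exact: bI.
  have pw w : `|Y' w - (1 + theta z * h) * (Y0 w - Y0 w * S1 w)
      - alpha l x * (Y1 w * X1 w)|
      <= C * (\1_(two_jumps X t (t + 2 * h)) w + h ^+ 2 + h * (E1 w * X1 w)).
    have := @step_pointwise _ _ adj o d Omega X hX hG theta alpha x l K t h w.
    move=> /(_ lx (alpha_ge0 _ _) t0 h0 hM (ltW h1) (K1 w) (K2 w) (K3 w)).
    set rhs := (X in _ <= X); set lhs := (X in `|X|) => le.
    rewrite [X in `|X|](_ : _ = \1_B w * lhs); last first.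
      by rewrite /lhs /Y' /Y0 /Y1 /S1 /X1; ring.
    rewrite normrM (ger0_norm (indic_ge0 _ _)); apply: le_trans le.
    exact: indic_mul_le.
  apply: le_trans (Ex_pointwise_le P C0 bY' bY0 bS1 bY1 bX1 bJ bE1 pw) _.
  rewrite ler_wpM2l// mul1r -addrA; apply: lerD => //; rewrite lerD2l.
  have -> : h * el h + r * h ^+ 2 = h * (el h + r * h) by ring.
  by rewrite ler_wpM2l// ltW.
rewrite -/T -/r.
change (weighted_prob P B z (t + h)) with (Ex P Y').
change (weighted_prob P B z t) with (Ex P Y0).
change (weighted_prob P B l t) with (Ex P Y1).
set a' := Ex P Y' in main *; set a := Ex P Y0 in main a00 a0K hS *.
set a1 := Ex P Y1 in a10 a1K hQ *.
set s := Ex P _ in hS main; set q := Ex P (fun w => Y1 w * X1 w) in hQ main.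
have thh : `|theta z * h| <= 2^-1.
  rewrite normrM (gtr0_norm h0) (le_trans _ hM)// ler_wpM2r ?(ltW h0)//.
  by rewrite /M lerDr.
have E : a' - (1 + (theta z - T) * h) * a - alpha l x * r * h * a1 =
  (a' - (1 + theta z * h) * (a - s) - alpha l x * q)
  + (- ((1 + theta z * h) * (s - T * h * a))
     + (- (theta z * T * h ^+ 2 * a) + alpha l x * (q - r * h * a1))).
  by ring.
rewrite E /eps; apply: le_trans (ler_normD _ _) _; apply: lerD => //.
apply: le_trans (ler_normD _ _) _; apply: lerD.
  rewrite normrN normrM; apply: ler_pM => //.
  by apply: le_trans (ler_normD _ _) _; rewrite normr1; lra.
apply: le_trans (ler_normD _ _) _; apply: lerD.
  rewrite normrN normrM.
  have -> : `|theta z * T * h ^+ 2| = `|theta z| * T * h ^+ 2.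
    by rewrite normrM (ger0_norm (sqr_ge0 h)) normrM (ger0_norm T0).
  by rewrite mulrAC ler_wpM2r ?sqr_ge0// ler_wpM2l// mulr_ge0.
by rewrite normrM (ger0_norm (alpha_ge0 _ _)) -[leRHS]mulrA ler_wpM2l.
Qed.

End StepExpectation.

(** * Change of measure at a fixed time *)

Lemma damping_le1 {R : realType} (T h : R) : 0 <= T -> 0 < h -> h < (T + 1)^-1 ->
  `|1 + - T * h| <= 1.
Proof.
move=> T0 hh hT.
have hT1 : h * (T + 1) < 1 by rewrite -ltr_pdivlMr ?div1r// ltr_wpDl.
have Th0 : 0 <= T * h by rewrite mulr_ge0// ltW.
by rewrite ler_norml; apply/andP; split; lra.
Qed.

(** Both quantities obey the same recursion with the same source [Q], which drops out of the
    difference; a coefficient of modulus at most one keeps earlier errors from growing. *)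
Lemma contraction_step {R : realType} (A A' C C' Q c e1 e2 : R) : `|c| <= 1 ->
  `|A' - c * A - Q| <= e1 -> `|C' - c * C - Q| <= e2 ->
  `|A' - C'| <= `|A - C| + (e1 + e2).
Proof.
move=> c1 le1 le2.
have -> : A' - C' = c * (A - C) + ((A' - c * A - Q) - (C' - c * C - Q)) by ring.
apply: le_trans (ler_normD _ _) _; apply: lerD; first by rewrite normrM ler_piMl.
by apply: le_trans (ler_normB _ _) _; exact: lerD.
Qed.

Section Comparison.
Context {R : realType} {V : choiceType} (adj : rel V) (o : V).
Context {d : measure_display} {Omega : measurableType d} (X : Omega -> R -> V).
Hypothesis hX : nearest_neighbour_process X adj o.
Hypothesis cV : countable [set: V].
Hypothesis hG : simple_graph adj.
Hypothesis hdeg : bounded_degree adj.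
Variables (a : R) (Pa P1 : probability Omega R).
Hypothesis a0 : 0 < a.
Hypothesis hPa : orrw X adj a Pa.
Hypothesis hP1 : orrw X adj 1 P1.

(** Written as a difference of exit rates, the form in which it cancels in the forward equation; it
    equals (1 - a) times the number of unexplored edges at the current vertex. *)
Definition reinforced_theta (z : seq V) : R := total_rate adj 1 z - total_rate adj a z.

Local Notation Na := (weighted_prob X (fun=> 0) (fun _ _ => 1) Pa).
Local Notation N1 := (weighted_prob X reinforced_theta (rate a) P1).
Local Notation D B z t := (Na B z t - N1 B z t).

Lemma history_extends w x l t : history (X w) (x :: l) t -> extends adj l x.
Proof.
move=> hh; have [_ e [h _]] := history_cons hh; move: e h; case: l {hh} => [//|y l] /= [-> el] h.
have := jump_adj (hX.2 w) h; suff -> : y = X w (jtime (X w) (size l)) by [].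
by case: (size l) el => [|n] /= [].
Qed.

Lemma Ex0 (P : probability Omega R) (Y : Omega -> R) : (forall w, Y w = 0) -> Ex P Y = 0.
Proof. by move=> h; rewrite (_ : Y = fun=> 0) ?Ex_cst//; apply/funext. Qed.

Lemma weighted_prob_empty theta alpha (P : probability Omega R) B z t :
  (forall w, ~ history_set X z t w) -> weighted_prob X theta alpha P B z t = 0.
Proof.
by move=> h; apply: Ex0 => w; rewrite [\1_(history_set _ _ _) w]indicE memNset ?mul0r ?mulr0.
Qed.

Lemma rate1 (z : seq V) x : rate 1 z x = 1 :> R.
Proof. by rewrite /rate; case: ifP. Qed.

(** Induction on the history, since the source of the equation for [x :: l] involves only [l]. Both
    equations have diagonal coefficient minus [total_rate adj a z], and incoming coefficient
    [rate a l x], which is a jump rate on one side and a weight on the other. *)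
Lemma comparison_propagates s (B : set Omega) : 0 <= s -> (@measurable _ (past X s)) B ->
  (forall z, D B z s = 0) -> forall t, s <= t -> forall z, D B z t = 0.
Proof.
move=> s0 mB Ds t st z; elim: z t st => [|x l IH] t st.
  by rewrite !weighted_prob_empty ?subrr// => w /history_nil.
have [lx|nlx] := boolP (extends adj l x); last first.
  by rewrite !weighted_prob_empty ?subrr// => w /history_extends; rewrite (negbTE nlx).
set z := x :: l.
have [Ka Ka0 hKa] := weight_le X (fun=> 0) (fun _ _ => 1) z t.
have [Kb Kb0 hKb] := weight_le X (fun=> 0) (fun _ _ => 1) l t.
have [Kc Kc0 hKc] := weight_le X reinforced_theta (rate a) z t.
have [Kd Kd0 hKd] := weight_le X reinforced_theta (rate a) l t.
(* A common bound for the four weights up to time [t], as [step_Ex] asks for one constant. *)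
pose K := Ka + Kb + (Kc + Kd).
have K0 : 0 <= K by rewrite !addr_ge0.
have KaK : Ka <= K by rewrite /K -addrA lerDl !addr_ge0.
have KbK : Kb <= K by rewrite /K [Ka + Kb]addrC -addrA lerDl !addr_ge0.
have KcK : Kc <= K by rewrite /K addrCA lerDl !addr_ge0.
have KdK : Kd <= K by rewrite /K [Kc + Kd]addrC addrCA lerDl !addr_ge0.
have one0 : forall (l' : seq V) (x' : V), 0 <= 1 :> R by [].
have ra0 : forall l' (x' : V), 0 <= rate a l' x' by move=> l' x'; exact: rate_ge0.
have [e1 [h1 [e1s h10 he1]]] :=
  step_Ex hX cV hG hdeg (fun=> 0) one0 a0 hPa lx K0.
have [e2 [h2 [e2s h20 he2]]] :=
  step_Ex hX cV hG hdeg reinforced_theta ra0 ltr01 hP1 lx K0.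
have T0 : 0 <= total_rate adj a z by exact: total_rate_ge0.
pose T := total_rate adj a z.
pose h0 := Num.min (Num.min h1 h2) ((T + 1)^-1).
apply: (@gronwall0 R (fun u => D B z u) s t h0 (fun h => e1 h + e2 h) st) => //.
- by rewrite !lt_min h10 h20 invr_gt0 ltr_wpDl.
- exact: smallD.
move=> u h su hh; rewrite !lt_min => /andP[/andP[hh1 hh2] hT] uht.
have u0 := le_trans s0 su; have ut : u <= t by apply: le_trans uht; rewrite lerDl ltW.
have uh0 : 0 <= u + h by rewrite addr_ge0// ltW.
have mBu : (@measurable _ (past X u)) B by exact: past_le mB.
have {he1} := he1 u h B u0 hh hh1 mBu
  (fun w => le_trans (hKa u w u0 ut) KaK)
  (fun w => le_trans (hKb u w u0 ut) KbK)
  (fun w => le_trans (hKa _ w uh0 uht) KaK).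
have {he2} := he2 u h B u0 hh hh2 mBu
  (fun w => le_trans (hKc u w u0 ut) KcK)
  (fun w => le_trans (hKd u w u0 ut) KdK)
  (fun w => le_trans (hKc _ w uh0 uht) KcK).
rewrite -/z rate1 mul1r mulr1 sub0r /reinforced_theta.
have := IH u su => /eqP; rewrite subr_eq0 => /eqP ->.
rewrite -/T (_ : total_rate adj 1 z - T - total_rate adj 1 z = - T); last by ring.
set A' := Na B z (u + h); set A := Na B z u; set C' := N1 B z (u + h).
set C := N1 B z u; set Q := rate a l x * h * _ => le2 le1.
exact: (contraction_step (damping_le1 T0 hh hT) le1 le2).
Qed.

Lemma history0 w z : history (X w) z 0 <-> z = [:: o].
Proof.
have [X0 _ _] := hX.2 w.
have h0 : history (X w) [:: o] 0.
  exists 0%N; first by rewrite /= /jtime /= X0.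
  by split => //; apply: (tau_gtS (hX.2 w) (n := 0) (t := 0)).
by split => [h|->//]; exact: history_uniq h h0.
Qed.

(** At time 0 the history is [[:: o]] surely and every weight is 1. *)
Lemma comparison0 z : D setT z 0 = 0.
Proof.
have E theta alpha (P : probability Omega R) :
    weighted_prob X theta alpha P setT z 0 = (z == [:: o])%:R.
  rewrite -[RHS](Ex_cst P); congr Ex; apply/funext => w.
  rewrite indicT mul1r indicE.
  have -> : (w \in history_set X z 0) = (z == [:: o]).
    by apply/idP/eqP; rewrite in_setE /history_set /= history0.
  have [->|_] := eqVneq; last by rewrite mul0r.
  have st0 n : stopped_tau X n 0 w = 0.
    by apply/eqP; rewrite eq_le stopped_tau_le// stopped_tau_ge0.
  by rewrite /weight /= !st0 subrr mulr0 addr0 expR0 !mulr1.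
by rewrite !E subrr.
Qed.

End Comparison.

(** * From cylinders to the whole past of a fixed time *)

Section Cylinders.
Context {R : realType} {V : choiceType} (adj : rel V) (o : V).
Context {d : measure_display} {Omega : measurableType d} (X : Omega -> R -> V).
Hypothesis hX : nearest_neighbour_process X adj o.
Hypothesis cV : countable [set: V].
Hypothesis hG : simple_graph adj.
Hypothesis hdeg : bounded_degree adj.
Variables (a : R) (Pa P1 : probability Omega R).
Hypothesis a0 : 0 < a.
Hypothesis hPa : orrw X adj a Pa.
Hypothesis hP1 : orrw X adj 1 P1.

Local Notation theta1 := (reinforced_theta adj a).
Local Notation Na := (weighted_prob X (fun=> 0) (fun _ _ => 1) Pa).
Local Notation N1 := (weighted_prob X theta1 (rate a) P1).
Local Notation D B z t := (Na B z t - N1 B z t).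

Definition cylinder (L : seq (R * set V)) : set Omega :=
  [set w | forall q, q \in L -> q.2 (X w q.1)].

Lemma past_cylinder L t : (forall q, q \in L -> 0 <= q.1 <= t) ->
  (@measurable _ (past X t)) (cylinder L).
Proof.
elim: L => [|[s C] L IH] hL.
  rewrite (_ : cylinder _ = setT); first exact: (@measurableT _ (past X t)).
  by apply/seteqP; split.
rewrite (_ : cylinder _ = [set w | C (X w s)] `&` cylinder L); last first.
  apply/seteqP; split => w /=.
    move=> h; split; first by apply: (h (s, C)); exact: mem_head.
    by move=> q qL; apply: h; rewrite inE qL orbT.
  by move=> [h1 h2] q; rewrite inE => /predU1P[->|] //; exact: h2.
apply: (@measurableI _ (past X t)).
  by have /andP[s0 st] := hL (s, C) (mem_head _ _); exact: past_X.
by apply: IH => q qL; apply: hL; rewrite inE qL orbT.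
Qed.

(** The history at time [t] fixes the position at [t], so a constraint on that position either holds
    identically or fails identically. This is how a new constraint enters a cylinder. *)
Lemma weighted_prob_position theta alpha (P : probability Omega R) (B : set Omega)
    (C : set V) x l t :
  weighted_prob X theta alpha P (B `&` [set w | C (X w t)]) (x :: l) t =
  if `[< C x >] then weighted_prob X theta alpha P B (x :: l) t else 0.
Proof.
rewrite -(Ex_cst P (if _ then _ else _)).
have H w : history_set X (x :: l) t w -> X w t = x.
  by move=> h; have [] := history_cons h.
case: asboolP => Cx; rewrite Ex_cst.
  congr Ex; apply/funext => w.
  have [h|h] := pselect (history_set X (x :: l) t w); last first.
    by rewrite [\1_(history_set _ _ _) w]indicE memNset// mul0r !mulr0.
  congr (_ * _); rewrite !indicE in_setI.
  have -> : (w \in [set w0 | C (X w0 t)]) by rewrite in_setE /= (H _ h).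
  by rewrite andbT.
apply: Ex0 => w.
have [h|h] := pselect (history_set X (x :: l) t w); last first.
  by rewrite [\1_(history_set _ _ _) w]indicE memNset// mul0r mulr0.
rewrite [\1_(B `&` _) w]indicE memNset ?mul0r//= => -[_].
by rewrite (H _ h).
Qed.

Definition later (p q : R * set V) : bool := q.1 <= p.1.

(** With the latest constraint first: the induction hypothesis reaches that time, the constraint is
    added there, and the equality is propagated on to [t]. The head [(t, setT)] of the path
    condition only says that all times are at most [t]. *)
Lemma comparison_sorted_cylinder L t : 0 <= t ->
  (forall q, q \in L -> 0 <= q.1) -> path later (t, setT) L ->
  forall z, D (cylinder L) z t = 0.
Proof.
elim: L t => [|[s C] L IH] t t0 hL.
  move=> _ z; rewrite (_ : cylinder _ = setT); last by apply/seteqP; split.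
  apply: (comparison_propagates hX cV hG hdeg a0 hPa hP1 (lexx 0)) => //.
  by move=> z'; exact: (comparison0 hX).
rewrite /= => /andP[st pL].
have s0 : 0 <= s by apply: (hL (s, C)); exact: mem_head.
have hL' q : q \in L -> 0 <= q.1 by move=> qL; apply: hL; rewrite inE qL orbT.
have pL' : path later (s, setT) L by case: (L) pL.
have Lle q : q \in L -> 0 <= q.1 <= s.
  move=> qL; rewrite hL'//=.
  have tr : transitive later by move=> p q' r h1 h2; exact: le_trans h2 h1.
  by have := order_path_min tr pL' => /allP/(_ _ qL).
have E : cylinder ((s, C) :: L) = cylinder L `&` [set w | C (X w s)].
  apply/seteqP; split => w /=.
    move=> h; split; last by apply: (h (s, C)); exact: mem_head.
    by move=> q qL; apply: h; rewrite inE qL orbT.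
  by move=> [h2 h1] q; rewrite inE => /predU1P[->|] //; exact: h2.
move=> z; rewrite E; apply: (comparison_propagates hX cV hG hdeg a0 hPa hP1 s0) => //.
  apply: (@measurableI _ (past X s)); first exact: past_cylinder.
  exact: past_X.
move=> [|x l].
  by rewrite !weighted_prob_empty ?subrr// => w /history_nil.
rewrite !weighted_prob_position; case: ifP => _; last by rewrite subrr.
exact: IH.
Qed.

Lemma comparison_cylinder L t z : 0 <= t -> (forall q, q \in L -> 0 <= q.1 <= t) ->
  D (cylinder L) z t = 0.
Proof.
move=> t0 hL.
have -> : cylinder L = cylinder (path.sort later L).
  by apply/seteqP; split => w h q; [rewrite mem_sort|rewrite -(mem_sort later)]; exact: h.
apply: comparison_sorted_cylinder => //.
  by move=> q; rewrite mem_sort => /hL/andP[].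
have tot : total later by move=> p q; exact: le_total.
have := sort_sorted tot L; case E: (path.sort later L) => [//|q L'] /= ->.
rewrite andbT; have : q \in path.sort later L by rewrite E mem_head.
by rewrite mem_sort => /hL/andP[].
Qed.

Lemma weighted_probE theta alpha (P : probability Omega R) (B : set Omega) z t :
  0 <= t -> (@measurable _ (past X t)) B ->
  (weighted_prob X theta alpha P B z t)%:E =
  (\int[P]_(w in B) (\1_(history_set X z t) w * weight X theta alpha z t w)%:E)%E.
Proof.
move=> t0 mB; rewrite /weighted_prob ExE; last exact: (bounded_weighted hX cV).
rewrite [RHS]integral_mkcond; apply: eq_integral => w _.
rewrite patchE indicE; case: (w \in B); first by rewrite mul1r.
by rewrite mul0r.
Qed.

(** Cylinders are closed under intersection and generate the past, and the events on which the two
    sides agree form a Dynkin class. *)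
Lemma comparison_past (B : set Omega) t z : 0 <= t -> sigma_upto X t%:E B ->
  Na B z t = N1 B z t.
Proof.
move=> t0 hB.
pose G := [set A | exists2 L, forall q, q \in L -> 0 <= q.1 <= t & A = cylinder L].
pose DD := [set A | (@measurable _ (past X t)) A /\ Na A z t = N1 A z t].
have ra0 : forall l' (x' : V), 0 <= rate a l' x' by move=> l' x'; exact: rate_ge0.
have GI : setI_closed G.
  move=> _ _ [L1 h1 ->] [L2 h2 ->]; exists (L1 ++ L2).
    by move=> q; rewrite mem_cat => /orP[/h1|/h2].
  apply/seteqP; split => w.
    by move=> [k1 k2] q; rewrite mem_cat => /orP[/k1|/k2].
  by move=> k; split => q qL; apply: k; rewrite mem_cat qL ?orbT.
have GB : <<s G >> B.
  apply: sub_sigma_algebra2 hB => _ [s [C [s0 st ->]]].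
  exists [:: (s, C)]; first by move=> q; rewrite inE => /eqP -> /=; rewrite s0 -lee_fin.
  apply/seteqP; split => w /=.
    by move=> Cs q; rewrite inE => /eqP ->.
  by move=> /(_ (s, C)); apply; exact: mem_head.
suff : DD B by case.
have {}GB : <<d G >> B by rewrite setI_closed_g_dynkin_g_sigma_algebra.
apply: (smallest_sub _ _ GB); last first.
  move=> _ [L hL ->]; split; first exact: past_cylinder.
  by apply/eqP; rewrite -subr_eq0; apply/eqP; exact: comparison_cylinder.
have wT theta alpha (P : probability Omega R) :
   forall A, (@measurable _ (past X t)) A ->
   weighted_prob X theta alpha P (~` A) z t =
   weighted_prob X theta alpha P setT z t - weighted_prob X theta alpha P A z t.
  move=> A mA; rewrite /weighted_prob -ExB.
  - congr Ex; apply/funext => w; rewrite indicT !indicE in_setC.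
    by case: (w \in A) => /=; rewrite ?mul0r ?mul1r ?subrr ?subr0.
  - by apply: (bounded_weighted hX cV) => //; exact: (@measurableT _ (past X t)).
  - exact: (bounded_weighted hX cV).
have DT : DD setT.
  split; first exact: (@measurableT _ (past X t)).
  have := @comparison_cylinder [::] t z t0.
  rewrite (_ : cylinder _ = setT); last by apply/seteqP; split.
  by move=> h; apply/eqP; rewrite -subr_eq0; apply/eqP/h.
split => //.
  move=> A [mA eA]; split; first exact: (@measurableC _ (past X t)).
  by rewrite !wT// eA DT.2.
move=> F tF hF; split.
  by apply: (@bigcupT_measurable _ (past X t)) => k; case: (hF k).
have mF k : (@measurable _ (past X t)) (F k) by case: (hF k).
have mU : (@measurable _ (past X t)) (\bigcup_k F k).
  exact: (@bigcupT_measurable _ (past X t)).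
apply: EFin_inj; rewrite !weighted_probE//.
have mf theta alpha : measurable_fun (\bigcup_k F k)
    (fun w => (\1_(history_set X z t) w * weight X theta alpha z t w)%:E).
  apply/measurable_EFinP; apply: measurable_funTS.
  have [+ _] := bounded_weighted hX cV theta alpha z t0 (@measurableT _ (past X t)).
  rewrite (_ : (fun _ => _) =
    (fun w => \1_(history_set X z t) w * weight X theta alpha z t w))//.
  by apply/funext => w; rewrite indicT mul1r.
rewrite !ge0_integral_bigcup//.
- apply: eq_eseriesr => k _; rewrite -!weighted_probE//; congr EFin; exact: (hF k).2.
- by move=> k; exact: (past_measurable hX (mF k)).
- by move=> w _; rewrite lee_fin mulr_ge0 ?indic_ge0// weight_ge0.
- by move=> k; exact: (past_measurable hX (mF k)).
- by move=> w _; rewrite lee_fin mulr_ge0 ?indic_ge0// weight_ge0.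
Qed.

End Cylinders.

(** * Change of measure at a jump time *)

Section FrozenWeight.
Context {R : realType} {V : choiceType} (adj : rel V) (o : V).
Context {d : measure_display} {Omega : measurableType d} (X : Omega -> R -> V).
Hypothesis hX : nearest_neighbour_process X adj o.
Hypothesis cV : countable [set: V].
Variables (theta : seq V -> R) (alpha : seq V -> V -> R).

(** [hold_weight] with the jump times themselves instead of their truncations; the two agree once
    all jumps involved have occurred. *)
Fixpoint hold_until (z : seq V) (w : Omega) : R :=
  if z is x :: l then
    hold_until l w + theta z * (jtime (X w) (size z) - jtime (X w) (size l))
  else 0.

(* The weight at the time of the last jump recorded in [z]. *)
Definition frozen_weight (z : seq V) (w : Omega) : R :=
  jump_weight alpha z * expR (hold_until (behead z) w).

Lemma hold_weight_until z t w : 0 <= t -> (tau (X w) (size z) <= t%:E)%E ->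
  hold_weight X theta z t w = hold_until z w.
Proof.
move=> t0; elim: z => //= x l IH h; have h' := le_trans (tau_geS (X w) (size l)) h.
by rewrite IH// !stopped_tau_before.
Qed.

Lemma weight_frozen x l t w : 0 <= t -> history (X w) (x :: l) t ->
  weight X theta alpha (x :: l) t w =
  frozen_weight (x :: l) w * expR (theta (x :: l) * (t - jtime (X w) (size l))).
Proof.
move=> t0 hz; have [_ _ [h1 h2]] := history_cons hz.
rewrite /weight /frozen_weight -mulrA -expRD /= hold_weight_until//.
by rewrite (stopped_tau_before t0 h1) (stopped_tau_after t0 (ltW h2)).
Qed.

Lemma measurable_jtime n : measurable_fun setT (fun w => jtime (X w) n).
Proof.
apply: (measurability _ (RGenOInfty.measurableE R)).
move=> _ [_ [x ->] <-]; rewrite setTI.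
have mle t : measurable [set w | (tau (X w) n <= t%:E)%E].
  have [t0|t0] := leP 0 t.
    by apply: (past_measurable hX (t := t)); exact: (past_tau hX cV).
  rewrite (_ : [set _ | _] = set0)//; apply/seteqP; split => // w /=.
  by move=> h; have := le_trans (tau_ge0 (X w) n) h; rewrite lee_fin leNgt t0.
have [x0|x0] := ltP x 0.
  rewrite (_ : _ @^-1` _ = setT)//; apply/seteqP; split => // w _ /=.
  by rewrite in_itv /= andbT (lt_le_trans x0)// jtime_ge0.
(* [fine] sends an infinite jump time to 0, so above a nonnegative level finiteness must be required
   too. *)
rewrite (_ : _ @^-1` _ = ~` [set w | (tau (X w) n <= x%:E)%E] `&`
    \bigcup_k [set w | (tau (X w) n <= k%:R%:E)%E]).
  by apply: measurableI; [exact: measurableC|exact: bigcupT_measurable].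
apply/seteqP; split => w /=; rewrite in_itv /= andbT.
  move=> xj; have jp := le_lt_trans x0 xj.
  have fin : tau (X w) n = (jtime (X w) n)%:E.
    have := tau_ge0 (X w) n; rewrite /jtime; move: jp; rewrite /jtime.
    by case: (tau (X w) n) => //=; rewrite ltxx.
  split; first by rewrite fin; apply/negP; rewrite -ltNge lte_fin.
  exists (Num.truncn (jtime (X w) n)).+1 => //=.
  by rewrite fin lee_fin ltW// truncnS_gt.
by move=> [/negP h [k _ hk]]; rewrite -lte_fin -(jtimeE hk) ltNge.
Qed.

Lemma measurable_frozen_weight z : measurable_fun setT (frozen_weight z).
Proof.
apply: measurable_funM => //; apply: measurableT_comp => //.
case: z => [|x z] /=; first exact: measurable_cst.
elim: z => [|y l IH] /=; first exact: measurable_cst.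
apply: measurable_funD => //; apply: measurable_funM => //.
by apply: measurable_funB; exact: measurable_jtime.
Qed.

Lemma frozen_weight_ge0 z w : (forall l x, 0 <= alpha l x) -> 0 <= frozen_weight z w.
Proof.
by move=> al0; rewrite /frozen_weight mulr_ge0 ?expR_ge0// jump_weight_ge0.
Qed.

End FrozenWeight.

(** * Comparison on the cells of a time grid *)

Section StoppedComparison.
Context {R : realType} {V : choiceType} (adj : rel V) (o : V).
Context {d : measure_display} {Omega : measurableType d} (X : Omega -> R -> V).
Hypothesis hX : nearest_neighbour_process X adj o.
Hypothesis cV : countable [set: V].
Hypothesis hG : simple_graph adj.
Hypothesis hdeg : bounded_degree adj.
Variables (a : R) (Pa P1 : probability Omega R).
Hypothesis a0 : 0 < a.
Hypothesis hPa : orrw X adj a Pa.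
Hypothesis hP1 : orrw X adj 1 P1.

Local Notation theta1 := (reinforced_theta adj a).

Lemma weight_trivial z t w : weight X (fun=> 0) (fun _ _ => 1) z t w = 1 :> R.
Proof.
have j1 : jump_weight (fun _ _ => 1) z = 1 :> R.
  by elim: z => //= x l IH; case: l IH => // y l ->; rewrite mulr1.
rewrite /weight j1 mul1r (_ : hold_weight _ _ _ _ _ = 0) ?expR0//.
by elim: z {j1} => //= x l ->; rewrite mul0r addr0.
Qed.

Lemma weighted_prob_setI theta alpha (P : probability Omega R) (B : set Omega) z t :
  0 <= t -> (@measurable _ (past X t)) B ->
  (weighted_prob X theta alpha P B z t)%:E =
  (\int[P]_(w in B `&` history_set X z t) (weight X theta alpha z t w)%:E)%E.
Proof.
move=> t0 mB; rewrite /weighted_prob ExE; last exact: (bounded_weighted hX cV).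
rewrite [RHS]integral_mkcond; apply: eq_integral => w _.
rewrite patchE in_setI !indicE; case: (w \in B); case: (w \in history_set X z t);
 by rewrite /= ?mul1r ?mul0r.
Qed.

Variables (x : V) (l : seq V) (A : set Omega).
Local Notation z := (x :: l).
Local Notation n := (size l).
Hypothesis hA : stopped_sigma X (fun w => tau (X w) n) A.

(** Jump [n] falls in the k-th grid interval and history [z] still holds at its right end. An event
    of the stopped sigma-algebra restricted to that interval lies in the past of the right end,
    where the fixed-time comparison applies. *)
Definition cell (dt : R) (k : nat) : set Omega :=
  A `&` [set w | ((k%:R * dt)%:E <= tau (X w) n)%E /\ (tau (X w) n < (k.+1%:R * dt)%:E)%E]
    `&` history_set X z (k.+1%:R * dt).

Local Notation F := (frozen_weight X theta1 (rate a) z).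

Lemma measurable_cell0 dt k : 0 < dt -> (@measurable _ (past X (k.+1%:R * dt)))
  (A `&` [set w | ((k%:R * dt)%:E <= tau (X w) n)%E /\ (tau (X w) n < (k.+1%:R * dt)%:E)%E]).
Proof.
move=> dt0; set t := k.+1%:R * dt; set s := k%:R * dt.
have t0 : 0 <= t by rewrite mulr_ge0// ltW.
have s0 : 0 <= s by rewrite mulr_ge0// ltW.
have st : s <= t by rewrite ler_wpM2r ?ler_nat// ltW.
rewrite (_ : _ `&` _ = (A `&` [set w | (tau (X w) n <= t%:E)%E]) `&`
  [set w | (tau (X w) n < t%:E)%E] `\` [set w | (tau (X w) n < s%:E)%E]).
  apply: (@measurableD _ (past X t)).
    apply: (@measurableI _ (past X t)); first exact: (hA.2 t t0).
    exact: (past_tau_lt hX cV).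
  by apply: past_le st _; exact: (past_tau_lt hX cV).
apply/seteqP; split => w /=.
  by move=> [Aw [h1 h2]]; rewrite (ltW h2); split => //; rewrite ltNge => /negP; apply.
by move=> [[[Aw _] h2] h1]; split => //; split => //; rewrite leNgt; apply/negP.
Qed.

Lemma measurable_cell dt k : 0 < dt -> measurable (cell dt k).
Proof.
move=> dt0; apply: measurableI.
  exact: (past_measurable hX (measurable_cell0 (k := k) dt0)).
by apply: (measurable_history_set hX); rewrite mulr_ge0 // ltW.
Qed.

Lemma cell_comparison dt k : 0 < dt ->
  Pa (cell dt k) =
  (\int[P1]_(w in cell dt k) (weight X theta1 (rate a) z (k.+1%:R * dt) w)%:E)%E.
Proof.
move=> dt0; have t0 : 0 <= k.+1%:R * dt by rewrite mulr_ge0// ltW.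
have mB := measurable_cell0 (k := k) dt0.
rewrite -weighted_prob_setI// -(comparison_past hX cV hG hdeg a0 hPa hP1)//.
rewrite weighted_prob_setI//.
under eq_integral do rewrite weight_trivial.
by rewrite integral_cst ?mul1e//; exact: measurable_cell.
Qed.

(** Between the jump and the right end of the grid interval the weight changes by a factor exp(theta
    u) with u at most [dt], so freezing it at the jump costs at most the factor [c]. *)
Lemma cell_bounds dt k (c : R) : 0 < dt -> c = expR (`|theta1 z| * dt) ->
  (Pa (cell dt k) <= c%:E * \int[P1]_(w in cell dt k) (F w)%:E)%E /\
  (\int[P1]_(w in cell dt k) (F w)%:E <= c%:E * Pa (cell dt k))%E.
Proof.
move=> dt0 ->; have t0 : 0 <= k.+1%:R * dt by rewrite mulr_ge0// ltW.
have mC := measurable_cell k dt0.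
have F0 w : (0 <= (F w)%:E)%E by rewrite lee_fin frozen_weight_ge0// => l' x'; exact: rate_ge0.
have W0 t w : (0 <= (weight X theta1 (rate a) z t w)%:E)%E.
  by rewrite lee_fin weight_ge0// => l' x'; exact: rate_ge0.
have mF : measurable_fun (cell dt k) (fun w => (F w)%:E).
  by apply/measurable_EFinP/measurable_funTS/(measurable_frozen_weight hX cV).
have mW : measurable_fun (cell dt k)
    (fun w => (weight X theta1 (rate a) z (k.+1%:R * dt) w)%:E).
  apply/measurable_EFinP/measurable_funTS.
  by apply: (past_measurable_fun hX (t := k.+1%:R * dt)); exact: (measurable_weight hX cV).
have E w : cell dt k w -> exists2 u, `|u| <= `|theta1 z| * dt &
    weight X theta1 (rate a) z (k.+1%:R * dt) w = F w * expR u.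
  move=> [[_ [h1 h2]] hz]; rewrite (weight_frozen _ _ t0 hz).
  have [_ _ [h3 _]] := history_cons hz; rewrite (jtimeE h3) in h1 h2.
  rewrite !lee_fin !lte_fin in h1 h2.
  eexists; last reflexivity.
  rewrite normrM ler_wpM2l// ger0_norm ?subr_ge0 ?(ltW h2)//.
  by rewrite lerBlDl -natr1 mulrDl mul1r lerD2r.
have e0 : 0 <= expR (`|theta1 z| * dt) by exact: expR_ge0.
rewrite cell_comparison//; split.
  rewrite -ge0_integralZl_EFin//; apply: ge0_le_integral => //.
  - by apply: measurable_funeM.
  - move=> w /E[u hu ->]; rewrite -EFinM lee_fin mulrC ler_wpM2r ?frozen_weight_ge0//.
      by move=> l' x'; exact: rate_ge0.
    by rewrite ler_expR (le_trans (ler_norm _)).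
rewrite -ge0_integralZl_EFin//; apply: ge0_le_integral => //.
- by apply: measurable_funeM.
- move=> w /E[u hu ->]; rewrite -EFinM lee_fin mulrCA ler_peMr ?frozen_weight_ge0//.
    by move=> l' x'; exact: rate_ge0.
  rewrite -expRD -[leLHS]expR0 ler_expR.
  by move: hu; rewrite ler_norml => /andP[? _]; lra.
Qed.

End StoppedComparison.

(** An infinite [W] makes the claim trivial; otherwise the factors pass to the limit. *)
Lemma le_of_cvg_factor {R : realType} (U W : \bar R) (c : R^nat) (u : (\bar R)^nat) :
  (0 <= W)%E -> c @ \oo --> (1 : R) -> u @ \oo --> U ->
  (forall m, (u m <= (c m)%:E * W)%E) -> (U <= W)%E.
Proof.
move=> W0 c1 uU le; case: W W0 le => [W| |] // W0 le; last by rewrite leey.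
have cv : ((c m)%:E * W%:E)%E @[m --> \oo] --> W%:E.
  have h : c m * W @[m --> \oo] --> 1 * W by exact: cvgMr_tmp.
  by rewrite mul1r in h; apply: cvg_EFin; [exact: nearW|exact: h].
exact: (lee_cvg_to uU cv (nearW _ le)).
Qed.

(** * Refining the grid *)

Section GridLimit.
Context {R : realType} {V : choiceType} (adj : rel V) (o : V).
Context {d : measure_display} {Omega : measurableType d} (X : Omega -> R -> V).
Hypothesis hX : nearest_neighbour_process X adj o.
Hypothesis cV : countable [set: V].
Hypothesis hG : simple_graph adj.
Hypothesis hdeg : bounded_degree adj.
Variables (a : R) (Pa P1 : probability Omega R).
Hypothesis a0 : 0 < a.
Hypothesis hPa : orrw X adj a Pa.
Hypothesis hP1 : orrw X adj 1 P1.
Local Notation theta1 := (reinforced_theta adj a).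
Variables (x : V) (l : seq V) (A : set Omega).
Local Notation z := (x :: l).
Local Notation n := (size l).
Hypothesis hA : stopped_sigma X (fun w => tau (X w) n) A.
Local Notation F := (frozen_weight X theta1 (rate a) z).

(** Dyadic, so that each grid refines the previous one. *)
Definition mesh (m : nat) : R := 2^-1 ^+ m.

Lemma mesh_gt0 m : 0 < mesh m. Proof. by rewrite exprn_gt0. Qed.

Definition grid_set (m : nat) : set Omega := \bigcup_k cell X x l A (mesh m) k.

Definition traced_set : set Omega :=
  A `&` [set w | (tau (X w) n < +oo)%E /\ trace (X w) n = z].

Lemma cellP dt k w : 0 < dt -> cell X x l A dt k w <->
  [/\ A w, trace (X w) n = z, tau (X w) n = (jtime (X w) n)%:E,
      k%:R * dt <= jtime (X w) n /\ jtime (X w) n < k.+1%:R * dt &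
      ((k.+1%:R * dt)%:E < tau (X w) n.+1)%E].
Proof.
move=> dt0; split.
  move=> [[Aw [h1 h2]] hz]; have [_ h3 [h4 h5]] := history_cons hz.
  have E := jtimeE h4; split => //.
  by split; [rewrite -lee_fin -E|rewrite -lte_fin -E].
move=> [Aw h1 E [h2 h3] h4]; split; first split => //=.
  by rewrite E lee_fin lte_fin.
by exists n => //; split => //; rewrite E lee_fin ltW.
Qed.

Lemma trivIset_cell dt : 0 < dt -> trivIset setT (cell X x l A dt).
Proof.
move=> dt0; apply/trivIsetP => i j _ _; apply: contra_neqP => /eqP/set0P[w [hi hj]].
have /(cellP _ _ dt0)[_ _ _ [i1 i2] _] := hi.
have /(cellP _ _ dt0)[_ _ _ [j1 j2] _] := hj.
have := le_lt_trans i1 j2; have := le_lt_trans j1 i2.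
by rewrite !ltr_pM2r// !ltr_nat => *; lia.
Qed.

(** A grid interval splits into halves 2k and 2k + 1; the half containing the jump ends no later
    than the interval, so the history still holds at its right end. *)
Lemma nondecreasing_grid_set : nondecreasing_seq grid_set.
Proof.
apply/nondecreasing_seqP => m; rewrite subsetEset => w [k _].
move=> /(cellP _ _ (mesh_gt0 m))[Aw h1 E [h2 h3] h4].
have dE : mesh m = 2 * mesh m.+1 by rewrite /mesh exprS mulrA divff ?mul1r.
rewrite dE !mulrA in h2 h3 h4; have d0 := mesh_gt0 m.+1.
have [lt|le] := ltP (jtime (X w) n) ((k * 2).+1%:R * mesh m.+1).
  exists (k * 2)%N => //; apply/(cellP _ _ d0); split => //.
    by rewrite natrM.
  apply: le_lt_trans h4; rewrite lee_fin ler_pM2r// -natrM ler_nat; lia.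
exists (k * 2).+1%N => //; apply/(cellP _ _ d0).
have e : (k * 2).+2%:R = k.+1%:R * 2 :> R by rewrite -natrM; congr (_%:R); lia.
by split => //; rewrite e.
Qed.

(** The next jump comes strictly later, so a fine enough grid has a point between the two jumps. *)
Lemma bigcup_grid_set : \bigcup_m grid_set m = traced_set.
Proof.
apply/seteqP; split => w.
  move=> [m _ [k _ /(cellP _ _ (mesh_gt0 m))[Aw h1 E _ _]]].
  by split => //; split => //; rewrite E ltry.
move=> [Aw [fin h1]].
have E : tau (X w) n = (jtime (X w) n)%:E.
  by rewrite /jtime fineK// ge0_fin_numE// tau_ge0.
have lt : (tau (X w) n < tau (X w) n.+1)%E.
  by apply: (tau_gtS (hX.2 w) (t := jtime (X w) n)); rewrite E.
have [m hm] : exists m, ((jtime (X w) n + mesh m)%:E < tau (X w) n.+1)%E.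
  case tE : (tau (X w) n.+1) lt => [u| |]; rewrite E ?lte_fin => ju.
  - have c0 : mesh @ \oo --> 0 by apply: cvg_expr; rewrite ger0_norm//; lra.
    have /cvgrPdist_lt/(_ (u - jtime (X w) n)) := c0.
    rewrite subr_gt0 => /(_ ju)[m _ /(_ m (leqnn m))] /=.
    rewrite sub0r normrN gtr0_norm ?mesh_gt0// => lt.
    by exists m; rewrite lte_fin; lra.
  - by exists 0%N; rewrite ltry.
  - by [].
pose k := Num.truncn (jtime (X w) n / mesh m).
have m0 := mesh_gt0 m.
have j0 : 0 <= jtime (X w) n / mesh m by rewrite divr_ge0 ?jtime_ge0// ltW.
have k1 : k%:R * mesh m <= jtime (X w) n by rewrite -ler_pdivlMr// truncn_le.
exists m => //; exists k => //; apply/(cellP _ _ m0); split => //.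
  by split => //; rewrite -ltr_pdivrMr// truncnS_gt.
by apply: le_lt_trans hm; rewrite lee_fin -natr1 mulrDl mul1r lerD2r.
Qed.

Lemma measurable_grid_set m : measurable (grid_set m).
Proof.
apply: bigcupT_measurable => k.
exact: (measurable_cell hX cV x hA k (mesh_gt0 m)).
Qed.

Lemma measurable_traced_set : measurable traced_set.
Proof. by rewrite -bigcup_grid_set; exact/bigcupT_measurable/measurable_grid_set. Qed.

Lemma frozen_ge0 w : (0 <= (F w)%:E)%E.
Proof. by rewrite lee_fin frozen_weight_ge0// => l' x'; exact: rate_ge0. Qed.

Lemma measurable_frozen D : measurable_fun D (fun w => (F w)%:E).
Proof.
by apply/measurable_EFinP/measurable_funTS/(measurable_frozen_weight hX cV).
Qed.

Lemma grid_bounds m (c : R) : c = expR (`|theta1 z| * mesh m) ->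
  (Pa (grid_set m) <= c%:E * \int[P1]_(w in grid_set m) (F w)%:E)%E /\
  (\int[P1]_(w in grid_set m) (F w)%:E <= c%:E * Pa (grid_set m))%E.
Proof.
move=> cE; have d0 := mesh_gt0 m; have c0 : (0 <= c) by rewrite cE expR_ge0.
have b k := cell_bounds hX cV hG hdeg a0 hPa hP1 hA k d0 cE.
have mC k : measurable (cell X x l A (mesh m) k).
  exact: (measurable_cell hX cV x hA k d0).
rewrite measure_semi_bigcup//; [|exact: trivIset_cell|exact: measurable_grid_set].
rewrite ge0_integral_bigcup//; [|exact: measurable_frozen|by move=> *; exact: frozen_ge0|exact: trivIset_cell].
split; rewrite -nneseriesZl.
- by apply: lee_nneseries => k _; [move=> _; exact: measure_ge0|exact: (b k).1].
- by move=> k _; apply: integral_ge0 => w _; exact: frozen_ge0.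
- apply: lee_nneseries => k _; last exact: (b k).2.
  by move=> _; apply: integral_ge0 => w _; exact: frozen_ge0.
- by move=> k _; exact: measure_ge0.
Qed.

(** Each side is at most the other up to a factor tending to 1 as the mesh shrinks, while the grid
    sets increase to the whole event. *)
Lemma traced_comparison : Pa traced_set = (\int[P1]_(w in traced_set) (F w)%:E)%E.
Proof.
pose c m := expR (`|theta1 z| * mesh m).
have c1 : c @ \oo --> (1 : R).
  rewrite -(expR0) -(mulr0 `|theta1 z|); apply: continuous_cvg.
    exact: continuous_expR.
  apply: cvgMl_tmp; apply: cvg_expr; rewrite ger0_norm//; lra.
have cvgP : Pa (grid_set m) @[m --> \oo] --> Pa traced_set.
  rewrite -bigcup_grid_set; apply: nondecreasing_cvg_mu.
  - exact: measurable_grid_set.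
  - by rewrite bigcup_grid_set; exact: measurable_traced_set.
  - exact: nondecreasing_grid_set.
have cvgI : (\int[P1]_(w in grid_set m) (F w)%:E)%E @[m --> \oo] -->
    (\int[P1]_(w in traced_set) (F w)%:E)%E.
  rewrite -bigcup_grid_set; apply: ge0_nondecreasing_set_cvg_integral.
  - exact: nondecreasing_grid_set.
  - exact: measurable_grid_set.
  - by move=> i; exact: measurable_frozen.
  - by move=> i w _; exact: frozen_ge0.
have sub m : grid_set m `<=` traced_set.
  by rewrite -bigcup_grid_set; exact: bigcup_sup.
have c0 m : (0 <= (c m)%:E)%E by rewrite lee_fin expR_ge0.
apply/eqP; rewrite eq_le; apply/andP; split.
- apply: (le_of_cvg_factor _ c1 cvgP) => [|m].
    by apply: integral_ge0 => w _; exact: frozen_ge0.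
  have [h _] := grid_bounds (erefl (c m)); apply: le_trans h _.
  apply: lee_wpmul2l => //; apply: ge0_subset_integral => //.
  - exact: measurable_grid_set.
  - exact: measurable_traced_set.
  - exact: measurable_frozen.
  - by move=> w _; exact: frozen_ge0.
- apply: (le_of_cvg_factor _ c1 cvgI) => [|m].
    exact: measure_ge0.
  have [_ h] := grid_bounds (erefl (c m)); apply: le_trans h _.
  apply: lee_wpmul2l => //; apply: le_measure => //; rewrite inE.
  - exact: measurable_grid_set.
  - exact: measurable_traced_set.
Qed.

End GridLimit.

(** * Time spent along unexplored edges *)

Section UnreinforcedTime.
Context {R : realType} {V : choiceType} (adj : rel V) (o : V) (p : R -> V).
Hypothesis hp : nearest_neighbour_path adj o p.
Hypothesis hG : simple_graph adj.
Hypothesis hdeg : bounded_degree adj.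
Local Notation lebesgue := (@lebesgue_measure R).

Definition incident_indic (e : set V) (u : R) : \bar R := (\1_[set u : R | e (p u)] u)%:E.

Definition window (e : set V) (T : \bar R) : set R :=
  [set u : R | (0 <= u%:E <= Order.min (first_traversal p e) T)%E].

Lemma first_traversal_gt e n t : (tau p n <= t%:E)%E -> ~ edges_along (trace p n) e ->
  (tau p n.+1 <= first_traversal p e)%E.
Proof.
move=> nt ne; apply: le_ereal_inf_tmp => _ [s hs <-].
have [m [ms me]] := (traversesP hp e s).1 hs.
rewrite leNgt; apply/negP => sn; apply: ne; rewrite edges_along_trace; exists m => //.
rewrite ltnNge; apply/negP => nm.
by have := le_lt_trans (@tau_le _ _ p n.+1 m.+1 nm) (_ : (tau p m.+1 < tau p n.+1)%E);
  rewrite ltxx ms => /(_ sn).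
Qed.

Lemma first_traversal_le e n t : (tau p n <= t%:E)%E -> edges_along (trace p n) e ->
  (first_traversal p e <= tau p n)%E.
Proof.
move=> nt; rewrite edges_along_trace => -[k kn ke].
have h : (tau p k.+1 <= tau p n)%E by exact: tau_le.
apply: (le_trans _ h); apply: ereal_inf_lbound; exists (jtime p k.+1).
  by apply/(traversesP hp); exists k; split => //; exact: jtimeE (le_trans h nt).
by rewrite -(jtimeE (le_trans h nt)).
Qed.

Lemma first_traversal_ge0 e : (0 <= first_traversal p e)%E.
Proof. by apply: le_ereal_inf_tmp => _ [s [s0 _] <-]; rewrite lee_fin ltW. Qed.

Lemma incident_const n t u : (tau p n <= t%:E)%E -> jtime p n <= u ->
  (u%:E < tau p n.+1)%E -> forall e, incident_indic e u = (`[< e (p (jtime p n)) >]%:R)%:E.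
Proof.
move=> nt nu un e; rewrite /incident_indic indicE; congr (_%:R%:E).
rewrite -(const_after nt nu un); congr nat_of_bool.
Qed.

(** The indicator is constant on each of finitely many holding intervals; needed to split the
    integral at the jump times. *)
Lemma measurable_incident e n t : (tau p n <= t%:E)%E ->
  measurable_fun `[0, jtime p n]%classic (incident_indic e).
Proof.
elim: n => [|n IH] nt.
  by rewrite jtime0 set_itv1; exact: measurable_fun_set1.
have nt' := le_trans (tau_geS p n) nt.
have jn : jtime p n < jtime p n.+1.
  by rewrite -lte_fin -(jtimeE nt) -(jtimeE nt'); exact: (tau_gtS hp nt').
have -> : `[0, jtime p n.+1]%classic = `[0, jtime p n]%classic `|`
    (`]jtime p n, jtime p n.+1[%classic `|` [set jtime p n.+1]).
  apply/seteqP; split => u /=; rewrite !in_itv /=.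
    move=> /andP[u0 un]; have [le|lt] := leP u (jtime p n); first by left; rewrite u0.
    by right; move: un; rewrite le_eqVlt => /predU1P[->|un]; [right|left].
  have j0 := jtime_ge0 p n.
  by case=> [/andP[u0 un]|[/andP[u0 un]|->]]; apply/andP; split; lra.
apply/measurable_funU => //; first by apply: measurableU.
split; first exact: IH.
apply/measurable_funU => //; split; last exact: measurable_fun_set1.
apply: (@eq_measurable_fun _ _ _ _ _ (cst (`[< e (p (jtime p n)) >]%:R)%:E)) => // u.
rewrite inE /= in_itv /= => /andP[u0 un].
by rewrite (incident_const nt' (ltW u0))// (jtimeE nt) lte_fin.
Qed.

Definition fresh (n : nat) (e : set V) : bool :=
  `[< e (p (jtime p n)) /\ ~ edges_along (trace p n) e >].

Lemma unreinforced_time0 e : unreinforced_time p e (tau p 0) = 0%E.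
Proof.
rewrite /unreinforced_time (_ : [set _ | _] = [set 0]) ?integral_set1//.
apply/seteqP; split => u /=.
  by rewrite le_min !lee_fin => /andP[u0 /andP[_ u1]]; apply/eqP; rewrite eq_le u0 u1.
by move=> ->; rewrite le_min first_traversal_ge0 !lexx.
Qed.

(** An explored edge has a window that no longer grows. An unexplored one cannot be traversed before
    jump [n.+1], so its window gains the whole holding interval, which counts exactly when the edge
    is incident to the current vertex. *)
Lemma unreinforced_timeS e n t : (tau p n.+1 <= t%:E)%E ->
  unreinforced_time p e (tau p n.+1) =
  (unreinforced_time p e (tau p n) +
    ((fresh n e)%:R * (jtime p n.+1 - jtime p n))%:E)%E.
Proof.
move=> nt; have nt' := le_trans (tau_geS p n) nt.
have jn : jtime p n < jtime p n.+1.
  by rewrite -lte_fin -(jtimeE nt) -(jtimeE nt'); exact: (tau_gtS hp nt').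
have mI := measurable_incident e nt.
have j0 := jtime_ge0 p n.
rewrite /unreinforced_time -!/(window e _).
have [he|he] := pselect (edges_along (trace p n) e).
  have Ln := first_traversal_le nt' he.
  have -> : fresh n e = false by apply/asboolP => -[].
  rewrite mul0r adde0; congr integral; apply/seteqP; split => u; rewrite /window /mkset;
    rewrite !le_min => /and3P[-> h1 h2]; rewrite h1/=.
    exact: le_trans h1 Ln.
  exact: le_trans h2 (tau_geS p n).
have nL := first_traversal_gt nt' he.
have W1 : window e (tau p n) = `[0, jtime p n]%classic.
  rewrite /window (jtimeE nt'); apply/seteqP; split => u /=; rewrite in_itv /= le_min !lee_fin.
    by move=> /and3P[-> _ ->].
  move=> /andP[-> un]; rewrite un andbT /=.
  by apply: le_trans nL; rewrite (jtimeE nt) lee_fin; lra.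
have W2 : window e (tau p n.+1) = `[0, jtime p n.+1]%classic.
  rewrite /window (jtimeE nt); apply/seteqP; split => u /=; rewrite in_itv /= le_min !lee_fin.
    by move=> /and3P[-> _ ->].
  move=> /andP[-> un]; rewrite un andbT /=.
  by apply: le_trans nL; rewrite (jtimeE nt) lee_fin.
(* The right endpoint is split off because the path has already jumped there; it has measure
   zero. *)
have W3 : `[0, jtime p n.+1]%classic = `[0, jtime p n]%classic `|`
   (`]jtime p n, jtime p n.+1[%classic `|` [set jtime p n.+1]).
  apply/seteqP; split => u /=; rewrite !in_itv /=.
    move=> /andP[u0 un]; have [le|lt] := leP u (jtime p n); first by left; rewrite u0.
    by right; move: un; rewrite le_eqVlt => /predU1P[->|un]; [right|left].
  by case=> [/andP[u0 un]|[/andP[u0 un]|->]]; apply/andP; split; lra.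
rewrite W1 W2 -!/(incident_indic e _).
have f0 u : (0 <= incident_indic e u)%E by rewrite lee_fin indicE.
rewrite W3 in mI *.
have /measurable_funU [|//|mI1 mI2] := mI; first by [].
  by apply: measurableU.
rewrite ge0_integral_setU//; [|exact: measurableU|]; last first.
  rewrite disj_set2E; apply/eqP; apply/seteqP; split => // u /= [].
  rewrite !in_itv /= => /andP[_ h1] [/andP[h2 _]|h2].
    by have := le_lt_trans h1 h2; rewrite ltxx.
  by rewrite h2 in h1; have := le_lt_trans h1 jn; rewrite ltxx.
congr (_ + _)%E.
rewrite ge0_integral_setU//; last first.
  rewrite disj_set2E; apply/eqP; apply/seteqP; split => // u /= [].
  by rewrite !in_itv /= => /andP[_ h1] h2; move: h1; rewrite h2 ltxx.
rewrite integral_set1 adde0.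
transitivity (\int[lebesgue]_(u in `]jtime p n, jtime p n.+1[%classic) ((fresh n e)%:R)%:E)%E.
  apply: eq_integral => u; rewrite inE /= in_itv /= => /andP[u0 un].
  have un' : (u%:E < tau p n.+1)%E by rewrite (jtimeE nt) lte_fin.
  apply: etrans (incident_const nt' (ltW u0) un' e) _; congr (_%:R%:E).
  congr nat_of_bool; apply/asboolP/asboolP => [h|[]//]; by split.
rewrite integral_cst//= lebesgue_measure_itv /= lte_fin jn -EFinB.
by rewrite EFinM.
Qed.

Lemma unreinforced_time_ge0 e T : (0 <= unreinforced_time p e T)%E.
Proof. by apply: integral_ge0 => u _; rewrite lee_fin indicE. Qed.

Definition unexplored (z : seq V) : R :=
  if z is i :: _ then \sum_(j <- nbr adj i) (~~ `[< edges_along z [set i; j] >])%:R else 0.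

Lemma total_rate_unexplored a z :
  total_rate adj 1 z - total_rate adj a z = (1 - a) * unexplored z.
Proof.
case: z => [|i l] /=; first by rewrite subrr mulr0.
rewrite -sumrB mulr_sumr; apply: eq_bigr => j _; rewrite /rate /=.
by case: asboolP => _; rewrite /= ?subrr ?mulr0 ?mulr1.
Qed.

Lemma trace_head n : exists l, trace p n = p (jtime p n) :: l.
Proof. by case: n => [|n]; eexists. Qed.

(** The map from j to the pair of i and j is a bijection from neighbours across unexplored edges to
    fresh edges; injectivity uses that there are no loops. The sum is thereby finite. *)
Lemma esum_fresh n (c : R) : 0 <= c ->
  (\esum_(e in edges adj) ((fresh n e)%:R * c)%:E = (unexplored (trace p n) * c)%:E)%E.
Proof.
move=> c0; have [l tE] := trace_head n; set i := p (jtime p n) in tE *.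
pose J : set V := [set j | adj i j /\ ~ edges_along (trace p n) [set i; j]].
have [sy ir] := hG.
have img : (fun j => [set i; j]) @` J = edges adj `&` [set e | fresh n e].
  apply/seteqP; split => e.
    move=> [j [ij nj] <-]; split; first by exists i, j.
    by apply/asboolP; split => //; left.
  move=> [[x [y [xy eE]]] /asboolP[ei ne]]; move: ei ne; rewrite eE => ei ne.
  case: ei => /= e1; rewrite -/i in e1.
    by exists y; rewrite /J /= -/i e1.
  exists x; last by rewrite -/i e1 setUC.
  rewrite /J /= -/i e1 setUC; split => //.
  by rewrite sy.
transitivity (\esum_(e in (fun j => [set i; j]) @` J) c%:E)%E.
  rewrite img esum_mkcondr; apply: eq_esum => e _.
  have -> : (e \in [set e | fresh n e]) = fresh n e.
    by apply/idP/idP => [|h]; rewrite in_setE.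
  by case: fresh; rewrite /= ?mul1r ?mul0r.
have inj : {in J &, injective (fun j => [set i; j])}.
  move=> j k; rewrite !inE => -[ij _] [ik _] E.
  have : [set i; k] j by rewrite -E; right.
  by case=> //= ji; move: ij; rewrite ji ir.
rewrite esum_image//.
have fJ : finite_set J.
  have [D hD] := hdeg; apply: sub_finite_set (card_le_finite (hD i) (finite_II D)).
  by move=> j [].
rewrite esum_fset// fsbig_finite//= /unexplored tE -/i mulr_suml.
rewrite sumEFin; congr EFin.
transitivity (\sum_(j <- nbr adj i | ~~ `[< edges_along (i :: l) [set i; j] >]) c).
  rewrite -[RHS]big_filter; apply: perm_big; apply: uniq_perm.
  - exact: fset_uniq.
  - by apply: filter_uniq; exact: nbr_uniq.
  move=> j; rewrite mem_filter mem_nbr// in_fset_set// -tE.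
  apply/idP/andP; rewrite in_setE.
    by move=> [ij nj]; split => //; apply/asboolPn.
  by move=> [/asboolPn nj ij].
by rewrite big_mkcond; apply: eq_bigr => j _; case: ifP => _; rewrite ?mul1r ?mul0r.
Qed.

Definition total_unreinforced (n : nat) : R :=
  \sum_(0 <= k < n) unexplored (trace p k) * (jtime p k.+1 - jtime p k).

Lemma esum_unreinforced n t : (tau p n <= t%:E)%E ->
  (\esum_(e in edges adj) unreinforced_time p e (tau p n) = (total_unreinforced n)%:E)%E.
Proof.
elim: n => [|n IH] nt.
  rewrite /total_unreinforced big_nil; apply: esum1 => e _.
  exact: unreinforced_time0.
have nt' := le_trans (tau_geS p n) nt.
have jn : 0 <= jtime p n.+1 - jtime p n.
  by rewrite subr_ge0 -lee_fin -(jtimeE nt) -(jtimeE nt'); exact: tau_geS.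
rewrite /total_unreinforced big_nat_recr//= EFinD -esum_fresh//.
rewrite -[X in (X%:E + _)%E]/(total_unreinforced n) -IH// -esumD.
- by apply: eq_esum => e _; exact: unreinforced_timeS nt.
- by move=> e _; exact: unreinforced_time_ge0.
- by move=> e _; rewrite lee_fin mulr_ge0.
Qed.

End UnreinforcedTime.

Lemma finite_edges_along (V : Type) (z : seq V) : finite_set (edges_along z).
Proof.
elim: z => [|x [|y l] IH] //=; try exact: finite_set0.
by rewrite finite_setU; split => //; exact: finite_set1.
Qed.

(** A newly traversed edge raises the cardinality by one and multiplies the weight by [a]; crossing
    an explored edge changes neither. *)
Lemma card_edges_along {R : realType} {V : choiceType} (a : R) (z : seq V) : 0 < a ->
  expR (ln a * #|` fset_set (edges_along z)|%:R) = jump_weight (rate a) z.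
Proof.
move=> a0; elim: z => [|x [|y l] IH].
- by rewrite fset_set0 cardfs0 mulr0 expR0.
- by rewrite fset_set0 cardfs0 mulr0 expR0.
have f := finite_edges_along (y :: l).
rewrite [edges_along _]/= -/(edges_along (y :: l)) fset_setU1// cardfsU1 natrD mulrDr.
rewrite expRD IH mulrC [in RHS]/=; congr (_ * _).
rewrite in_fset_set// /rate /=; case: asboolP => h.
  by rewrite mem_set//= mulr0 expR0.
by rewrite memNset//= mulr1 lnK.
Qed.

(** Summing over edges first and over holding intervals second identifies the time term with
    [hold_until] of the tail: the last vertex of the trace is only being reached at jump [n] and has
    no holding time yet. *)
Lemma integrand_frozen {R : realType} {V : choiceType} (adj : rel V) (o : V)
    (d : measure_display) (T : measurableType d) (X : T -> R -> V)
    (a : R) (n : nat) (w : T) :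
  nearest_neighbour_path adj o (X w) -> simple_graph adj -> bounded_degree adj ->
  0 < a -> (tau (X w) n < +oo)%E ->
  (expeR ((1 - a)%:E *
              (\esum_(e in edges adj)
                 unreinforced_time (X w) e (tau (X w) n))
            + (ln a * #|` fset_set (traversed_edges (X w) (tau (X w) n)) |%:R)%:E)
   = (frozen_weight X (reinforced_theta adj a) (rate a) (trace (X w) n) w)%:E)%E.
Proof.
move=> hp hG hdeg a0 fin.
have E : tau (X w) n = (jtime (X w) n)%:E.
  by rewrite /jtime fineK// ge0_fin_numE// tau_ge0.
have nt : (tau (X w) n <= (jtime (X w) n)%:E)%E by rewrite E.
rewrite (esum_unreinforced hp hG hdeg nt) -EFinM -EFinD /=.
rewrite (traversed_edges_trace hp (n := n))//; last exact: (tau_gtS hp nt).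
rewrite expRD card_edges_along// /frozen_weight mulrC; congr (_ * expR _)%:E.
elim: n {E nt fin} => [|n IH].
  by rewrite /total_unreinforced big_nil mulr0.
rewrite /total_unreinforced big_nat_recr//= mulrDr -/(total_unreinforced adj (X w) n) IH.
have [l tE] := trace_head (X w) n.
have sl : size l = n by have := size_trace (X w) n; rewrite tE => -[].
by rewrite tE /= sl /reinforced_theta total_rate_unexplored mulrA.
Qed.

(** * Finiteness of the jump times *)

Lemma countable_surj (T : Type) : countable [set: T] -> T ->
  exists g : nat -> T, forall z, exists k, g k = z.
Proof.
move=> /countable_injP[f injf] z0.
exists (fun k => if pselect (exists z, f z = k) is left h then sval (cid h) else z0).
move=> z; exists (f z); case: pselect => [h|[]]; last by exists z.
by case: cid => z' /= e; apply: injf => //; rewrite in_setE.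
Qed.

(** * Integrals of nonnegative functions without measurability *)

Section NullSets.
Context {R : realType} {d : measure_display} {T : measurableType d}.
Variable mu : {measure set T -> \bar R}.
Import HBNNSimple.

Lemma integral_mono (f g : T -> \bar R) : (forall w, (0 <= f w)%E) ->
  (forall w, (f w <= g w)%E) -> (\int[mu]_w f w <= \int[mu]_w g w)%E.
Proof.
move=> f0 fg; have g0 w : (0 <= g w)%E by exact: le_trans (f0 w) (fg w).
rewrite !ge0_integralTE//; apply: ereal_sup_le => _ [h /= hf <-].
by exists h => //= w; exact: le_trans (hf w) (fg w).
Qed.

(** The integral is a supremum over simple functions below [f], and for each of these, being
    measurable, the null set can be removed. *)
Lemma integral_null_set (f : T -> \bar R) (N : set T) :
  (forall w, (0 <= f w)%E) -> measurable N -> mu N = 0%E ->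
  (\int[mu]_w f w = \int[mu]_(w in ~` N) f w)%E.
Proof.
move=> f0 mN muN; rewrite [RHS]integral_mkcond; apply/eqP; rewrite eq_le.
have r0 w : (0 <= (f \_ (~` N)) w)%E by apply: erestrict_ge0.
apply/andP; split; last first.
  by apply: integral_mono => // w; rewrite patchE; case: ifP.
rewrite [leLHS]ge0_integralTE//; apply: ge_ereal_sup => _ [h /= hf <-].
rewrite -integralT_nnsfun (ge0_negligible_integral mN)//; last first.
- by move=> w _; rewrite lee_fin; exact: fun_ge0.
- by apply/measurable_EFinP.
rewrite setTD integral_mkcond; apply: integral_mono => w.
  by apply: erestrict_ge0 => ? _; rewrite lee_fin; exact: fun_ge0.
by rewrite !patchE; case: ifP.
Qed.

End NullSets.

Section TauFinite.
Context {R : realType} {V : choiceType} (adj : rel V) (o : V).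
Context {d : measure_display} {Omega : measurableType d} (X : Omega -> R -> V).
Hypothesis hX : nearest_neighbour_process X adj o.
Hypothesis cV : countable [set: V].
Hypothesis hG : simple_graph adj.
Hypothesis hdeg : bounded_degree adj.
Hypothesis hnbr : forall i, exists j, adj i j.
Variables (b : R) (P : probability Omega R).
Hypothesis b0 : 0 < b.
Hypothesis hP : orrw X adj b P.

Lemma total_rate_gt0 x l : 0 < total_rate adj b (x :: l).
Proof.
have [j xj] := hnbr x; rewrite /= (bigD1_seq j) ?mem_nbr ?nbr_uniq//=.
by apply: ltr_wpDr; [apply: sumr_ge0 => k _; exact: rate_ge0|exact: rate_gt0].
Qed.

(** A history [z] records [size z] minus one jumps, so [tau (X w) (size z)] is the next one, which
    never comes. *)
Definition stuck (z : seq V) (s : R) : set Omega :=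
  history_set X z s `&` [set w | tau (X w) (size z) = +oo%E].

Lemma measurable_tau_infty n : measurable [set w | tau (X w) n = +oo%E].
Proof.
rewrite (_ : [set _ | _] = ~` \bigcup_k [set w | (tau (X w) n <= (k%:R : R)%:E)%E]).
  apply: measurableC; apply: bigcupT_measurable => k.
  by apply: (past_measurable hX (t := k%:R)); exact: (past_tau hX cV).
apply/seteqP; split => w /=.
  by move=> h [k _ /=]; rewrite h leye_eq.
move=> h; apply: contrapT => fin; apply: h.
exists (Num.truncn (jtime (X w) n)).+1 => //=.
have -> : tau (X w) n = (jtime (X w) n)%:E.
  rewrite /jtime fineK// ge0_fin_numE ?tau_ge0// ltey; exact/eqP.
by rewrite lee_fin ltW// truncnS_gt.
Qed.

Lemma measurable_stuck z s : 0 <= s -> measurable (stuck z s).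
Proof.
move=> s0; apply: measurableI; first exact: (measurable_history_set hX).
exact: measurable_tau_infty.
Qed.

(** For every later t the event is contained in having history [z] at both times [s] and t, whose
    probability is lowered at the positive rate [total_rate] and so gets arbitrarily small. *)
Lemma stuck_null z s : 0 <= s -> P (stuck z s) = 0%E.
Proof.
move=> s0; case: z => [|x l].
  by rewrite (_ : stuck _ _ = set0) ?measure0//; apply/seteqP; split => // w [/history_nil].
have [lx|nlx] := boolP (extends adj l x); last first.
  rewrite (_ : stuck _ _ = set0) ?measure0//; apply/seteqP; split => // w [] /=.
  by move=> /(history_extends hX); rewrite (negbTE nlx).
set z := x :: l; set B := history_set X z s.
have mB : (@measurable _ (past X s)) B by exact: (past_history hX).
pose q := weighted_prob X (fun=> 0) (fun _ _ => 1) P B z.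
have one0 : forall (l' : seq V) (x' : V), 0 <= 1 :> R by [].
have [eps [h0 [epss h00 step]]] := step_Ex hX cV hG hdeg (fun=> 0) one0 b0 hP lx ler01.
have W1 z' t w : `|weight X (fun=> 0) (fun _ _ => 1) z' t w| <= 1 :> R.
  by rewrite weight_trivial normr1.
have q0 t : s <= t -> 0 <= q t.
  move=> st; apply: Ex_ge0 => w; rewrite weight_trivial.
  by rewrite mulr1 mulr_ge0 ?indic_ge0.
have T0 : 0 < total_rate adj b z by exact: total_rate_gt0.
have qstep t h : s <= t -> 0 < h -> h < h0 ->
    q (t + h) <= (1 - total_rate adj b z * h) * q t + eps h.
  move=> st hh hh0; have t0 := le_trans s0 st.
  have := step t h B t0 hh hh0 (past_le st mB) (W1 _ t) (W1 _ t) (W1 _ (t + h)).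
  (* No source term: having reached [z] by time [s], the history cannot be the shorter [l] at a
     later time. *)
  have -> : weighted_prob X (fun=> 0) (fun _ _ => 1) P B l t = 0.
    apply: Ex0 => w; have [h1|h1] := pselect (B w); last first.
      by rewrite [\1_B w]indicE memNset// mul0r.
    rewrite [\1_(history_set _ _ _) w]indicE memNset ?mul0r ?mulr0// => h2.
    have [_ _ k1] := history_cons h1.
    case: (l) h2 k1 => [/history_nil//|y l'] h2 k1; have [_ _ k2] := history_cons h2.
    by have := jumps_at_le k1 k2 st => /=; rewrite ltnn.
  rewrite mulr0 subr0 sub0r -/(q t) -/(q (t + h)) -/z mulNr => /(le_trans (ler_norm _)).
  by rewrite lerBlDl addrC.
have Ple c : 0 < c -> (P (stuck z s) <= c%:E)%E.
  move=> /(decay T0 h00 epss q0 qstep)[t st qc].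
  have t0 := le_trans s0 st.
  have mBt := past_le st mB.
  apply: (@le_trans _ _ (q t)%:E); last by rewrite lee_fin ltW.
  rewrite (weighted_prob_setI hX cV)//.
  under eq_integral do rewrite weight_trivial.
  have mBO := past_measurable hX mB.
  have mH : measurable (history_set X z t) by exact: (measurable_history_set hX).
  rewrite integral_cst ?mul1e; last exact: measurableI.
  apply: le_measure; rewrite ?inE; [exact: measurable_stuck|exact: measurableI|].
  move=> w [h1 h2]; split => //; have [_ k1 [k2 k3]] := history_cons h1.
  exists (size l) => //; split; first by apply: le_trans k2 _; rewrite lee_fin.
  by move: h2 => /= ->; rewrite ltry.
apply/eqP; rewrite eq_le measure_ge0 andbT; apply/lee_addgt0Pr => e e0.
by rewrite add0e; exact: Ple.
Qed.

(** If some jump time is infinite, the path is stuck after the last finite one, in one of countably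
    many histories, as witnessed at an integer time. *)
Lemma tau_infty_null n : P [set w | tau (X w) n = +oo%E] = 0%E.
Proof.
have [g gs] := countable_surj (countable_seq cV) [::].
apply/(negligibleP P (measurable_tau_infty n)).
apply: (negligibleS (A := \bigcup_i \bigcup_k stuck (g i) k%:R)); last first.
  apply: negligible_bigcup => i; apply: negligible_bigcup => k.
  apply/negligibleP; first exact: measurable_stuck.
  exact: stuck_null.
move=> w /=; elim: n => [//|n IH] tn.
have [tn'|/eqP tn'] := pselect (tau (X w) n = +oo%E); first exact: IH.
have E : tau (X w) n = (jtime (X w) n)%:E.
  by rewrite /jtime fineK// ge0_fin_numE ?tau_ge0// ltey.
have [i gi] := gs (trace (X w) n).
exists i => //; exists (Num.truncn (jtime (X w) n)).+1 => //; rewrite gi.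
split; last by rewrite /= size_trace.
by exists n => //; split; [rewrite E lee_fin ltW// truncnS_gt|rewrite tn ltry].
Qed.

End TauFinite.

(** * Change of measure on the stopped sigma-algebra *)

Local Open Scope ereal_scope.

Section ChangeOfMeasure.
Context {R : realType} {V : choiceType} (adj : rel V) (o : V).
Context {d : measure_display} {Omega : measurableType d} (X : Omega -> R -> V).
Hypothesis hX : nearest_neighbour_process X adj o.
Hypothesis hG : simple_graph adj.
Hypothesis hconn : connected_graph adj.
Hypothesis hdeg : bounded_degree adj.
Variables (a : R) (Pa P1 : probability Omega R).
Hypothesis a0 : (0 < a)%R.
Hypothesis hPa : orrw X adj a Pa.
Hypothesis hP1 : orrw X adj 1%R P1.
Variables (n : nat) (A : set Omega).
Hypothesis hA : stopped_sigma X (fun w => tau (X w) n) A.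

Definition density (w : Omega) : \bar R :=
  expeR ((1 - a)%:E *
              (\esum_(e in edges adj)
                 unreinforced_time (X w) e (tau (X w) n))
            + (ln a * #|` fset_set (traversed_edges (X w) (tau (X w) n)) |%:R)%:E).

Let cV : countable [set: V] := countable_connected o hconn hdeg.

Lemma change_of_measure_moving : (forall i, exists j, adj i j) ->
  Pa A = \int[P1]_w (density w * (\1_A w)%:E).
Proof.
move=> hnbr; have mA : measurable A := sigma_upto_measurable hX hA.1.
set N := [set w | tau (X w) n = +oo].
have mN : measurable N by exact: (measurable_tau_infty hX cV).
have d0 w : 0 <= density w * (\1_A w)%:E.
  by rewrite mule_ge0 ?expeR_ge0// lee_fin indicE.
(* [density] need not be measurable on the null set [N]. *)
rewrite (integral_null_set d0 mN (tau_infty_null hX cV hG hdeg hnbr ltr01 hP1 n)).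
have PaN : Pa (A `&` N) = 0.
  have := tau_infty_null hX cV hG hdeg hnbr a0 hPa n.
  by apply: subset_measure0 => //; exact: measurableI.
transitivity (Pa (A `\` N)).
  apply: etrans (measureDI Pa mA mN) _; rewrite -[RHS]adde0.
  by congr (_ + _); exact: PaN.
have [g gs] := countable_surj (countable_seq cV) [::].
have /countable_injP[f injf] := countable_seq cV.
(* The injection [f] codes traces by integers, so outside [N] the event [A] is a countable disjoint
   union of pieces with a fixed trace. *)
pose E k := A `&` [set w | tau (X w) n < +oo /\ f (trace (X w) n) = k].
have EE k : E k = set0 \/ exists x l, [/\ size l = n, f (x :: l) = k &
    E k = traced_set X x l A].
  have [[z [fz sz]]|h] := pselect (exists z, f z = k /\ size z = n.+1); last first.
    left; apply/seteqP; split => // w [_ [_ fk]]; apply: h.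
    by exists (trace (X w) n); rewrite size_trace.
  right; case: z fz sz => // x l fz [sz]; exists x, l; split => //.
  rewrite /traced_set /E sz; congr (_ `&` _); apply/seteqP; split => w /= [-> h]; split => //.
    by apply: injf; rewrite ?in_setE// h.
  by rewrite h.
have mE k : measurable (E k).
  have [->|[x [l [sl _ ->]]]] := EE k; first exact: measurable0.
  by apply: (measurable_traced_set hX cV); rewrite sl.
have tE : trivIset setT E.
  apply/trivIsetP => i j _ _; apply: contra_neqP => /eqP/set0P[w [[_ [_ hi]] [_ [_ hj]]]].
  by rewrite -hi -hj.
have UE : A `\` N = \bigcup_k E k.
  apply/seteqP; split => w.
    move=> [Aw nN]; exists (f (trace (X w) n)) => //; split => //; split => //.
    by rewrite ltey; exact/eqP.
  move=> [k _ [Aw [fin _]]]; split => // h.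
  by move: fin; rewrite /= h ltxx.
(* On one piece the density is a single frozen weight; measurability of the density is obtained
   piece by piece from this. *)
have densE k w : E k w -> exists2 F : Omega -> R, measurable_fun setT F &
    forall w', E k w' -> density w' = (F w')%:E /\ (0 <= F w')%R.
  move=> [_ [fin fk]]; exists (frozen_weight X (reinforced_theta adj a) (rate a) (trace (X w) n)).
    exact: (measurable_frozen_weight hX cV).
  move=> w' [_ [fin' fk']].
  have -> : trace (X w) n = trace (X w') n.
    by apply: injf; rewrite ?in_setE// fk fk'.
  split; last by apply: frozen_weight_ge0 => l' x'; exact: rate_ge0.
  by rewrite /density (integrand_frozen (hX.2 w') hG hdeg a0 fin').
have dge0 w : 0 <= density w by exact: expeR_ge0.
have mdens : measurable_fun (\bigcup_k E k) density.
  apply/(measurable_fun_bigcup _ mE) => k.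
  have [e|/eqP/set0P[w Ew]] := pselect (E k = set0).
    by rewrite e; exact: measurable_fun_set0.
  have [F mF hF] := densE k w Ew.
  apply: (@eq_measurable_fun _ _ _ _ _ (EFin \o F)).
    by move=> w'; rewrite inE => /hF[].
  by apply/measurable_EFinP; exact: measurable_funTS.
have mU : measurable (\bigcup_k E k) by exact: bigcupT_measurable.
rewrite UE; apply: etrans (measure_semi_bigcup Pa mE tE mU) _.
rewrite (_ : \int[P1]_(w in ~` N) (density w * (\1_A w)%:E) =
    \int[P1]_(w in \bigcup_k E k) density w); last first.
  rewrite -UE integral_mkcond [RHS]integral_mkcond; apply: eq_integral => w _.
  rewrite !patchE in_setD in_setC indicE andbC.
  by case: (w \in N); case: (w \in A); rewrite /= ?mule1 ?mule0.
rewrite (ge0_integral_bigcup P1 mE mdens _ tE)//.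
apply: eq_eseriesr => k _.
have [->|[x [l [sl fk eE]]]] := EE k; first by rewrite measure0 integral_set0.
have hA' : stopped_sigma X (fun w => tau (X w) (size l)) A by rewrite sl.
rewrite eE; apply: etrans (traced_comparison hX cV hG hdeg a0 hPa hP1 x hA') _; rewrite -eE.
apply: eq_integral => w; rewrite inE => Ew.
have [_ [fin fw]] := Ew; rewrite /density (integrand_frozen (hX.2 w) hG hdeg a0 fin).
by congr (frozen_weight _ _ _ _ _)%:E; apply: injf; rewrite ?in_setE// fk fw.
Qed.

(** By connectedness [i] is the only vertex. Jump times may be infinite here, but there are no
    edges, so the density is 1, and every event generated by positions is empty or full. *)
Lemma change_of_measure_isolated i : (forall j, ~ adj i j) ->
  Pa A = \int[P1]_w (density w * (\1_A w)%:E).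
Proof.
move=> hi.
have single y : y = i.
  have [[|j q] /=] := hconn i y; first by [].
  by move=> /andP[/hi].
have XE B t w : [set w | B (X w t)] w = B i :> Prop by rewrite /= (single (X w t)).
have triv : A = set0 \/ A = setT.
  apply: (smallest_sub (X := [set C | C = set0 \/ C = setT]) _ _ hA.1).
    split; first by left.
      by move=> C [->|->]; rewrite ?setTD ?setC0 ?setCT; [right|left].
    move=> F hF; have [[k Fk]|h] := pselect (exists k, F k = setT).
      by right; apply/seteqP; split => // w _; exists k; rewrite // Fk.
    left; apply/seteqP; split => // w [k _ Fkw].
    by have [e|e] := hF k; [rewrite e in Fkw|apply: h; exists k].
  move=> _ [s [B [_ _ ->]]]; have [Bi|nBi] := pselect (B i).
    by right; apply/seteqP; split => // w _; rewrite XE.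
  by left; apply/seteqP; split => // w; rewrite XE.
have densE w : density w = 1.
  rewrite /density (_ : edges adj = set0); last first.
    by apply/seteqP; split => // e [x [y [xy _]]]; apply: (hi y); rewrite -(single x).
  rewrite esum_set0 mule0 add0e (_ : traversed_edges _ _ = set0).
    by rewrite fset_set0 cardfs0 mulr0 /= expR0.
  apply/seteqP; split => // e [s [_ [_ [x [_ ne _]]]]]; apply: ne.
  by rewrite (single x) (single (X w s)).
case: triv => ->.
  rewrite measure0; under eq_integral do rewrite indic0 mule0.
  by rewrite integral0.
rewrite probability_setT; under eq_integral do rewrite indicT densE mule1.
by rewrite integral_cst// mul1e; exact/esym/probability_setT.
Qed.

Lemma change_of_measure : Pa A = \int[P1]_w (density w * (\1_A w)%:E).
Proof.
have [h|/existsNP[i /forallNP hi]] := pselect (forall i, exists j, adj i j).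
  exact: change_of_measure_moving.
exact: (change_of_measure_isolated hi).
Qed.

End ChangeOfMeasure.

Unset Implicit Arguments.

Theorem proposition1p4 (R : realType) (V : Type) (adj : rel V) (o : V)
    (hG : simple_graph adj) (hconn : connected_graph adj)
    (hdeg : bounded_degree adj)
    (d : measure_display) (Omega : measurableType d) (X : Omega -> R -> V)
    (hX : nearest_neighbour_process X adj o)
    (a : R) (ha : (0 < a)%R)
    (Pa P1 : probability Omega R)
    (hPa : orrw X adj a Pa) (hP1 : orrw X adj 1%R P1)
    (n : nat) (A : set Omega)
    (hA : stopped_sigma X (fun w => tau (X w) n) A) :
  Pa A =
  \int[P1]_w
    (expeR ((1 - a)%:E *
              (\esum_(e in edges adj)
                 unreinforced_time (X w) e (tau (X w) n))
            + (ln a * #|` fset_set (traversed_edges (X w) (tau (X w) n)) |%:R)%:E)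
     * (\1_A w)%:E).
Proof.
(* [{classic V}] equips the bare type [V] with the classical choice structure that the finite
   enumerations of neighbours require. *)
exact: (@change_of_measure R {classic V} adj o d Omega X hX hG hconn hdeg a Pa P1
  ha hPa hP1 n A hA).
Qed.
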